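(* Let $\varepsilon\in(0,1)$, let $F,F_0$ be distribution functions of probability measures on $[0,\infty)$ with $F_0\prec F$, and assume $\mathbb{E}Y_F<\infty$ and $\mathbb{E}Y_{F_0}<\infty$. Then $$\lim_{n\to\infty}\frac{T_\eta(0,n\mathbf e_2)}{n}=\mu_{F_0}(\mathbf e_2)\quad\text{with } (\mathbf P_\varepsilon\times\mathbb P)\text{-probability one}.$$
   Context: Let $\mathbf P_\varepsilon$ be the product measure on $\{0,1\}^{\mathbb{Z}}$ under which each coordinate $\eta_x$ equals $1$ with probability $\varepsilon$. Independently, let $(\xi_e)_{e\in\mathcal E}$ be i.i.d. uniform on $[0,1]$ indexed by nearest-neighbour edges of $\mathbb{Z}^2$, with law $\mathbb P$. For a distribution function $G$, $G^{-1}(u)=\min\{x:G(x)\ge u\}$. Given $\eta$, each vertical edge $e=\{(x,y),(x,y+1)\}$ gets weight $\tau_e=F^{-1}(\xi_e)$ if $\eta_x=0$ and $F_0^{-1}(\xi_e)$ if $\eta_x=1$; each horizontal edge $e=\{(x,y),(x+1,y)\}$ gets $F_0^{-1}(\xi_e)$ if $\eta_x=\eta_{x+1}=1$ and $F^{-1}(\xi_e)$ otherwise. $T_\eta(u,v)$ is the infimum over nearest-neighbour paths from $u$ to $v$ of the sum of these weights. For a distribution $G$, $Y_G$ is the minimum of four i.i.d. $G$ variables and $\mu_G(x)$ is the time constant of homogeneous first-passage percolation with i.i.d. $G$ weights (the limit in probability of $T_G(0,nx)/n$). $F_0\prec F$ means $\int\phi\,dF_0\le\int\phi\,dF$ for every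 concave non-decreasing $\phi:\mathbb{R}\to\mathbb{R}$ for which both integrals converge absolutely. $\mathbf e_2=(0,1)$. *)

(* Defs.v *)
From HB Require Import structures.
From mathcomp Require Import all_boot all_order all_algebra.
From mathcomp Require Import all_classical all_reals all_analysis.
Set Implicit Arguments. Unset Strict Implicit. Unset Printing Implicit Defensive.
Import Order.TTheory GRing.Theory Num.Theory.
Import numFieldNormedType.Exports.
Local Open Scope classical_set_scope.
Local Open Scope ring_scope.

Definition vertex := (int * int)%type.

(* Nearest-neighbour edges of Z^2:  (v, false) is the horizontal edge
   {(x,y),(x+1,y)} and (v, true) the vertical edge {(x,y),(x,y+1)}, v=(x,y). *)
Definition edge := (vertex * bool)%type.

Definition adj (a b : vertex) : bool :=
  (`|a.1 - b.1|%N + `|a.2 - b.2|%N == 1)%N.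

Definition edge_of (a b : vertex) : edge :=
  if a.2 == b.2 then ((Order.min a.1 b.1, a.2), false)
  else ((a.1, Order.min a.2 b.2), true).

Definition path_time {R : realType} (w : edge -> R) (u : vertex) (p : seq vertex) : R :=
  \sum_(ab <- zip (u :: p) p) w (edge_of ab.1 ab.2).

Definition passage_time {R : realType} (w : edge -> R) (u v : vertex) : R :=
  inf [set t : R | exists p : seq vertex,
         [/\ path adj u p, last u p = v & t = path_time w u p]].

Definition e2 : vertex := (0%R, 1%R).
Definition origin : vertex := (0%R, 0%R).
Definition scalev (n : nat) (v : vertex) : vertex := (v.1 *+ n, v.2 *+ n).

Definition cdf {R : realType} (mu : probability R R) (x : R) : R :=
  fine (mu [set y : R | y <= x]).

(* generalized inverse G^{-1}(u) = min {x : G(x) >= u} (written as inf,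
   which coincides with the min for u in (0,1] by right-continuity) *)
Definition qf {R : realType} (mu : probability R R) (u : R) : R :=
  inf [set x : R | u <= cdf mu x].

Definition supported_nonneg {R : realType} (mu : probability R R) : Prop :=
  mu [set x : R | 0 <= x] = 1%E.

Definition concave_fun {R : realType} (phi : R -> R) : Prop :=
  forall (x y t : R), 0 <= t <= 1 ->
    t * phi x + (1 - t) * phi y <= phi (t * x + (1 - t) * y).

Definition concave_order {R : realType} (mu0 mu : probability R R) : Prop :=
  forall phi : R -> R, concave_fun phi -> {homo phi : x y / x <= y} ->
    mu0.-integrable setT (fun x => (phi x)%:E) ->
    mu.-integrable setT (fun x => (phi x)%:E) ->
    (\int[mu0]_x (phi x)%:E <= \int[mu]_x (phi x)%:E)%E.

Definition mutually_independent {d} {Omega : measurableType d} {R : realType}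
  (P : probability Omega R) {I : eqType} (X : I -> Omega -> R) : Prop :=
  (forall i, measurable_fun setT (X i)) /\
  forall (J : seq I) (B : I -> set R), uniq J -> (forall i, measurable (B i)) ->
    P [set w | forall i, i \in J -> B i (X i w)] =
    (\prod_(i <- J) P [set w | B i (X i w)])%E.

Definition tau_eta {R : realType} (mu mu0 : probability R R)
  (eta : int -> bool) (xi : edge -> R) (e : edge) : R :=
  let x := e.1.1 in
  if e.2 then (if eta x then qf mu0 (xi e) else qf mu (xi e))
  else (if eta x && eta (x + 1) then qf mu0 (xi e) else qf mu (xi e)).

Definition joint_family {d} {Omega : measurableType d} {R : realType}
  (eta : int -> Omega -> R) (xi : edge -> Omega -> R) : (int + edge)%type -> Omega -> R :=
  fun i => match i with inl x => eta x | inr e => xi e end.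

Definition origin_edges : seq edge :=
  [:: (origin, false); ((-1, 0), false); (origin, true); ((0, -1), true)].

(* Y_G realised as min of G^{-1}(xi_e) over the four edges at the origin,
   i.e. the minimum of four i.i.d. G variables *)
Definition Y_of {d} {Omega : measurableType d} {R : realType}
  (mu : probability R R) (xi : edge -> Omega -> R) (w : Omega) : R :=
  \big[Order.min/qf mu (xi (origin, false) w)]_(e <- origin_edges) qf mu (xi e w).

(* Main.v *)
Require Import Defs.
From HB Require Import structures.
From mathcomp Require Import all_boot all_order all_algebra.
From mathcomp Require Import all_classical all_reals all_analysis.
From mathcomp Require Import measurable_realfun.
From mathcomp Require Import zify ring lra.
Import Order.TTheory GRing.Theory Num.Theory.
Import numFieldNormedType.Exports.
Local Open Scope classical_set_scope.
Local Open Scope ring_scope.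
Set Implicit Arguments. Unset Strict Implicit. Unset Printing Implicit Defensive.

(* Let T be the passage time and write T_0 for the homogeneous F_0 passage time;
   the constant is m = inf_n E T_0(0, n e_2) / n.

   Integrability: adjacent sites are joined by four edge-disjoint paths, so the
   cheapest of the four is bounded by a finite sum of minima of four weights.

   Lower bound in mean: T is a concave nondecreasing function of each weight, so
   replacing F by F_0 edge by edge (resampling one uniform variable at a time) only
   decreases the mean; hence E T_eta(0, n e_2) >= E T_0(0, n e_2) >= n m.

   Upper bound almost surely: choose k and a finite family of paths from 0 to k e_2
   whose cheapest member has F_0-mean below k (m + e). Almost surely some run of
   columns with eta = 1 is wide enough to contain the vertical translates of this
   family; inside it the cost of climbing is a Birkhoff sum, and the cost of leaving
   the run at any height is sublinear. Hence limsup T_eta(0, n e_2) / n <= m.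

   Lower bound almost surely: as in Kingman's theorem, if T_eta(0, n e_2) - c n were
   unbounded below with positive probability for some c < m, then jumping along good
   lengths (rate c on this invariant event, rate m + e off it) would give
   E T_eta(0, n e_2) < n m for large n. The case F = F_0 identifies m as the
   time constant. *)

(** * Product measures on cylinder spaces *)

(** The vertical shift leaves [eta] in place, so it is not ergodic on the environment of T_eta, and
    no ergodic theorem is applied to T_eta itself. Almost sure statements come from a zero-one law
    for events that ignore finitely many coordinates; it is used for sums of vertical translates of
    functions of finitely many edges and for the existence of wide runs. Abnormally fast growth of
    T_eta is merely a shift-invariant event, which a priori may have any probability; it is excluded
    because off this event the upper bound already gives the rate m + e, while the mean of T_eta(0,
    n e_2) is at least n m. So a lower bound in mean suffices, but it needs the almost sure upper
    bound first. The order between F_0 and F tests functions that are concave on the whole line and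
    integrable for both laws. Minima over finite families of paths, capped by a constant, qualify;
    passage times are reached by limits. All of this takes place on the space of families of reals,
    where shifting and replacing one coordinate are maps. *)

Definition cyl_sets (I : Type) (R : realType) : set (set (I -> R)) :=
  [set C | exists i, exists2 B : set R, measurable B & C = [set f | B (f i)]].

Definition cyl (I : Type) (R : realType) := g_sigma_algebraType (@cyl_sets I R).

Section image_measure.
Context d d' (T : measurableType d) (T' : measurableType d') (R : realType).

Lemma exists_image_measure (m : {measure set T -> \bar R}) (f : T -> T') :
  measurable_fun setT f ->
  exists m' : {measure set T' -> \bar R}, forall A, m' A = m (f @^-1` A).
Proof. by move=> mf; unshelve eexists (pushforward m f). Qed.

End image_measure.

Section cylinder.
Context {I : eqType} {R : realType}.
Implicit Types (J : seq I) (B : I -> set R).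

Definition box J B : set (cyl I R) := [set f | forall i, i \in J -> B i (f i)].

Lemma measurable_coord (i : I) : measurable_fun setT (fun f : cyl I R => f i).
Proof.
move=> _ B mB; rewrite setTI; apply: sub_sigma_algebra; exists i.
by exists B.
Qed.

Lemma measurable_box J B : (forall i, measurable (B i)) -> measurable (box J B).
Proof.
move=> mB; have -> : box J B = \big[setI/setT]_(i <- J) ((fun f : cyl I R => f i) @^-1` B i).
  elim: J => [|j J IH]; first by rewrite big_nil; apply/seteqP; split.
  rewrite big_cons -IH; apply/seteqP; split => f /=.
    by move=> h; split=> [|i iJ]; apply: h; rewrite inE ?eqxx // iJ orbT.
  by move=> [h1 h2] i; rewrite inE => /orP[/eqP->|/h2].
elim/big_ind : _ => //; first by move=> ? ? ? ?; exact: measurableI.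
by move=> i _; rewrite -[X in measurable X]setTI; exact: measurable_coord.
Qed.

Definition boxes : set (set (cyl I R)) :=
  [set A | exists J B, [/\ uniq J, (forall i, measurable (B i)) & A = box J B]].

Lemma boxes_setI : setI_closed boxes.
Proof.
move=> _ _ [J [B [uJ mB ->]]] [J' [B' [uJ' mB' ->]]].
exists (undup (J ++ J')), (fun i => (if i \in J then B i else setT) `&`
                                    (if i \in J' then B' i else setT)).
split; first exact: undup_uniq.
  by move=> i; apply: measurableI; case: ifP.
apply/seteqP; split => f /=.
  move=> [h h'] i; rewrite mem_undup mem_cat => _.
  by split; case: ifP => // /[dup] iJ; [move/h|move/h'].
move=> h; split => i iJ; have := h i; rewrite mem_undup mem_cat iJ ?orbT => /(_ isT) [];
 by [].
Qed.

Lemma sigma_boxes (A : set (cyl I R)) : measurable A -> <<s boxes >> A.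
Proof.
apply: smallest_sub; first exact: smallest_sigma_algebra.
move=> _ [i [B mB ->]]; apply: sub_sigma_algebra; exists [:: i], (fun=> B); split => //.
apply/seteqP; split => f /=; first by move=> h j; rewrite inE => /eqP ->.
by apply; rewrite inE.
Qed.

Lemma cyl_measure_unique (m1 m2 : {measure set (cyl I R) -> \bar R}) :
  (m1 setT < +oo)%E ->
  (forall J B, uniq J -> (forall i, measurable (B i)) -> m1 (box J B) = m2 (box J B)) ->
  forall A, measurable A -> m1 A = m2 A.
Proof.
move=> m1oo m12 A mA.
have boxT : box [::] (fun=> setT) = setT by apply/seteqP; split.
apply: (@g_sigma_algebra_measure_unique _ _ _ boxes _ (fun=> setT)) => //.
- by move=> _ [J [B [_ mB ->]]]; exact: measurable_box.
- by move=> _; exists [::], (fun=> setT); rewrite boxT.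
- by apply/seteqP; split => // x _; exists 0%N.
- exact: boxes_setI.
- by move=> _ [J [B [uJ mB ->]]]; exact: m12.
- exact: sigma_boxes.
Qed.

Lemma measurable_to_cyl d (T : measurableType d) (X : T -> cyl I R) :
  (forall i, measurable_fun setT (fun t => X t i)) -> measurable_fun setT X.
Proof.
move=> mX; apply: (@measurability _ _ T (cyl I R) setT X (@cyl_sets I R) erefl).
by move=> _ [_ [i [B mB ->]] <-]; exact: mX.
Qed.

(** Uniqueness on the pi-system of boxes: as functions of [A] both sides are finite measures, the
    left one an image of a restriction of [Q], the right one an image of [Q] scaled by [Q C]. *)
Lemma indep_cyl d (T : measurableType d) (Q : probability T R) (Z : T -> cyl I R)
    (C : set T) : measurable_fun setT Z -> measurable C ->
  (forall J B, uniq J -> (forall i, measurable (B i)) ->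
     Q (Z @^-1` box J B `&` C) = (Q (Z @^-1` box J B) * Q C)%E) ->
  forall A, measurable A -> Q (Z @^-1` A `&` C) = (Q (Z @^-1` A) * Q C)%E.
Proof.
move=> mZ mC h A mA.
have QC0 : 0 <= fine (Q C) by exact/fine_ge0.
have [m1 m1E] := exists_image_measure (mrestr Q mC) mZ.
have [m2 m2E] := exists_image_measure Q mZ.
have e X : mscale (NngNum QC0) m2 X = (Q (Z @^-1` X) * Q C)%E.
  by rewrite /mscale /= fineK ?fin_num_measure // m2E muleC.
have <- : m1 A = Q (Z @^-1` A `&` C) by rewrite m1E.
rewrite -e; apply: cyl_measure_unique mA.
  by rewrite m1E /= /mrestr (le_lt_trans (probability_le1 _ _)) ?ltry // preimage_setT setTI.
by move=> J B uJ mB; rewrite m1E /= -[RHS]/(mscale _ _ _) e -h.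
Qed.

End cylinder.

Definition pull (I I' : Type) (R : realType) (s : I' -> I) (f : cyl I R) : cyl I' R :=
  fun i => f (s i).

Lemma measurable_pull (I I' : eqType) (R : realType) (s : I' -> I) :
  measurable_fun setT (@pull I I' R s).
Proof. by apply: measurable_to_cyl => i; exact: measurable_coord. Qed.

Section product_law.
Context {I : eqType} {R : realType} (Q : probability (cyl I R) R).
Hypothesis indepQ : forall (J : seq I) (B : I -> set R), uniq J ->
  (forall i, measurable (B i)) ->
  Q (box J B) = (\prod_(i <- J) Q [set f | B i (f i)])%E.

(** Kolmogorov's argument. Overwriting the coordinates in [J] by 0 does not affect membership in
    [A], so [A] is independent of every box over [J]; boxes generate, hence [A] is independent of
    itself. *)
Lemma zero_one_law (A : set (cyl I R)) : measurable A ->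
  (forall (J : seq I) f g, (forall i, i \notin J -> f i = g i) -> A f -> A g) ->
  Q A = 0%E \/ Q A = 1%E.
Proof.
move=> mA tailA.
pose z (J : seq I) (f : cyl I R) : cyl I R := fun i => if i \in J then 0 else f i.
have mz J : measurable_fun setT (z J).
  apply: measurable_to_cyl => i; rewrite /z; case: (i \in J) => //.
  exact: measurable_coord.
have zA J : z J @^-1` A = A.
  apply/seteqP; split => f /=; apply: (tailA J) => i iJ; by rewrite /z (negbTE iJ).
have stepA J B : uniq J -> (forall i, measurable (B i)) ->
    Q (A `&` box J B) = (Q A * Q (box J B))%E.
  move=> uJ mB; rewrite -{1 2}(zA J).
  apply: indep_cyl => //; first exact: measurable_box.
  move=> J' B' uJ' mB'.
  (* After overwriting, the conditions at indices in [J] only ask whether 0 lies in [B']. If one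
     fails the event is empty; otherwise the indices of [J'] outside [J] remain. *)
  have [h0|h0] := pselect (forall i, i \in J' -> i \in J -> B' i 0); last first.
    have -> : z J @^-1` box J' B' = set0.
      apply/seteqP; split => // f /= h; apply: h0 => i iJ' iJ.
      by have := h i iJ'; rewrite /z iJ.
    by rewrite set0I measure0 mul0e.
  pose J1 := [seq i <- J' | i \notin J].
  have -> : z J @^-1` box J' B' = box J1 B'.
    apply/seteqP; split => f /= h i.
      by rewrite mem_filter => /andP[iJ iJ']; have := h i iJ'; rewrite /z (negbTE iJ).
    move=> iJ'; rewrite /z; case: ifPn => iJ; first exact: h0.
    by apply: h; rewrite mem_filter iJ.
  have uJ1 : uniq J1 by rewrite filter_uniq.
  have -> : box J1 B' `&` box J B =
      box (J1 ++ J) (fun i => if i \in J then B i else B' i).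
    apply/seteqP; split => f /=.
      by move=> [h1 h2] i; rewrite mem_cat; case: ifP => iJ; [move=> _; exact: h2|rewrite orbF; exact: h1].
    move=> h; split => i iJ; have := h i; rewrite mem_cat iJ ?orbT => /(_ isT) //.
    by move: iJ; rewrite mem_filter => /andP[/negbTE ->].
  rewrite !indepQ //; first last.
  - by move=> i; case: ifP.
  - rewrite cat_uniq uJ1 uJ andbT; apply/hasPn => i iJ /=.
    by rewrite mem_filter iJ.
  rewrite big_cat /=; congr (_ * _)%E; apply: eq_big_seq => i.
    by rewrite mem_filter => /andP[/negbTE ->].
  by move=> ->.
have /(_ A mA) : forall A', measurable A' -> Q (id @^-1` A' `&` A) = (Q (id @^-1` A') * Q A)%E.
  apply: indep_cyl => // J B uJ mB.
  by rewrite setIC stepA // muleC.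
rewrite /= setIid => QAA.
have : Q A \is a fin_num by exact: fin_num_measure.
case: (Q A) QAA => // r [] rr _.
have : r * (1 - r) = 0 by rewrite mulrBr mulr1 -rr subrr.
by move=> /eqP; rewrite mulf_eq0 => /orP[/eqP->|]; [left|rewrite subr_eq0 => /eqP <-; right].
Qed.

(** Independence makes both image laws products with equal one-dimensional marginals. With [t] the
    identity this is shift invariance; with edge-valued maps it moves four edges to any other
    four. *)
Lemma reindex_law (I' : eqType) (s t : I' -> I) :
  injective s -> injective t ->
  (forall i B, measurable B -> Q [set f | B (f (s i))] = Q [set f | B (f (t i))]) ->
  forall A : set (cyl I' R), measurable A ->
  Q (pull s @^-1` A) = Q (pull t @^-1` A).
Proof.
move=> injs injt st A mA.
have [m1 m1E] := exists_image_measure Q (@measurable_pull _ _ R s).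
have [m2 m2E] := exists_image_measure Q (@measurable_pull _ _ R t).
have key (u : I' -> I) J B : injective u -> uniq J -> (forall i, measurable (B i)) ->
    Q (pull u @^-1` box J B) = (\prod_(i <- J) Q [set f | B i (f (u i))])%E.
  move=> inju uJ mB.
  (* [B] transported along [u]. Injectivity gives back [B j] at [u j]; at indices not coming from
     [J] the condition is vacuous, which keeps [B'] measurable. *)
  pose B' i := [set x | forall j, j \in J -> u j = i -> B j x].
  have B'u j : j \in J -> B' (u j) = B j.
    move=> jJ; apply/seteqP; split => x; first by apply.
    by move=> Bx k kJ /inju ->.
  have mB' i : measurable (B' i).
    have [[j jJ <-]|h] := pselect (exists2 j, j \in J & u j = i); first by rewrite B'u.
    suff -> : B' i = setT by [].
    by apply/seteqP; split => // x _ j jJ ji; exfalso; apply: h; exists j.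
  have -> : (pull u @^-1` box J B) = box (map u J) B'.
    apply/seteqP; split => f /=.
      by move=> h _ /mapP[j jJ ->]; rewrite B'u //; exact: h.
    by move=> h j jJ; rewrite -B'u //; apply: h; exact: map_f.
  rewrite indepQ ?map_inj_uniq //.
  by rewrite big_map; apply: eq_big_seq => j jJ; rewrite B'u.
transitivity (m1 A); first by rewrite m1E.
transitivity (m2 A); last by rewrite m2E.
apply: cyl_measure_unique mA.
  by rewrite m1E (le_lt_trans (probability_le1 _ _)) ?ltry // preimage_setT.
move=> J B uJ mB; rewrite m1E m2E.
transitivity (\prod_(i <- J) Q [set f | B i (f (s i))])%E; first exact: key.
transitivity (\prod_(i <- J) Q [set f | B i (f (t i))])%E; last exact/esym/key.
by apply: eq_bigr => i _; exact: st.
Qed.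

Definition upd (f : cyl I R) (e : I) (u : R) : cyl I R :=
  fun i => if i == e then u else f i.

Lemma measurable_upd e :
  measurable_fun setT (fun p : cyl I R * cyl I R => upd p.1 e (p.2 e)).
Proof.
apply: measurable_to_cyl => i; rewrite /upd; case: (i == e).
  by apply: (measurableT_comp (f := fun f : cyl I R => f e)); [exact: measurable_coord|exact: measurable_snd].
by apply: (measurableT_comp (f := fun f : cyl I R => f i)); [exact: measurable_coord|exact: measurable_fst].
Qed.

(** Coordinate [e] is replaced by that of an independent copy: [upd] carries the product of [Q] with
    itself to [Q], as seen on boxes, and Tonelli's theorem splits the integral. The inner integral
    then freezes every other coordinate. *)
Lemma resample (e : I) (H : cyl I R -> \bar R) :
  measurable_fun setT H -> (forall f, 0 <= H f)%E ->
  (\int[Q]_f H f = \int[Q]_f \int[Q]_g H (upd f e (g e)))%E.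
Proof.
move=> mH H0.
have mu_ := measurable_upd e.
have [m mE] := exists_image_measure (product_measure1 Q Q) mu_.
have Qm A : measurable A -> Q A = m A.
  apply: cyl_measure_unique.
    exact: (le_lt_trans (probability_le1 Q measurableT) (ltry _)).
  move=> J B uJ mB; rewrite mE.
  have [eJ|eJ] := boolP (e \in J).
    have -> : (fun p : cyl I R * cyl I R => upd p.1 e (p.2 e)) @^-1` box J B =
        box (rem e J) B `*` [set f | B e (f e)].
      apply/seteqP; split => -[f g] /=.
        move=> h; split; last by have := h e eJ; rewrite /upd eqxx.
        by move=> i; rewrite mem_rem_uniq // inE => /andP[/negbTE ne iJ]; have := h i iJ; rewrite /upd ne.
      move=> [h1 h2] i iJ; rewrite /upd; case: eqP => [->//|/eqP ne].
      by apply: h1; rewrite mem_rem_uniq // inE ne.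
    transitivity (Q (box (rem e J) B) * Q [set f | B e (f e)])%E.
      apply: etrans (indepQ uJ mB) _.
      by rewrite (indepQ (rem_uniq e uJ) mB) (big_rem e eJ) /= [LHS]muleC.
    apply/esym/product_measure1E; first exact: measurable_box.
    by rewrite -[X in measurable X]setTI; exact: measurable_coord.
  have -> : (fun p : cyl I R * cyl I R => upd p.1 e (p.2 e)) @^-1` box J B = box J B `*` setT.
    apply/seteqP; split => -[f g] /=.
      move=> h; split => // i iJ; have := h i iJ; rewrite /upd; case: eqP => // ie.
      by move: eJ; rewrite -ie iJ.
    move=> [h _] i iJ; rewrite /upd; case: eqP => [ie|_]; last exact: h.
    by move: eJ; rewrite -ie iJ.
  transitivity (Q (box J B) * Q setT)%E.
    by rewrite [Q setT](@probability_setT _ _ _ Q) mule1.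
  by apply/esym/product_measure1E => //; exact: measurable_box.
rewrite (eq_measure_integral m); last by move=> A mA _; exact: Qm.
rewrite (eq_measure_integral (pushforward (product_measure1 Q Q) (fun p : cyl I R * cyl I R => upd p.1 e (p.2 e)))); last first.
  by move=> A mA _; rewrite mE.
rewrite ge0_integral_pushforward //.
rewrite preimage_setT fubini_tonelli1 //=.
exact: (measurableT_comp mH).
Qed.

Lemma measurable_resample (e : I) (H : cyl I R -> \bar R) :
  measurable_fun setT H -> (forall f, 0 <= H f)%E ->
  measurable_fun setT (fun f => \int[Q]_g H (upd f e (g e)))%E.
Proof.
move=> mH H0; have mHu : measurable_fun setT (fun p : cyl I R * cyl I R => H (upd p.1 e (p.2 e))).
  exact: (measurableT_comp mH (measurable_upd e)).
exact: (measurable_fun_fubini_tonelli_F (m2 := Q) _ mHu).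
Qed.

End product_law.

(** * Ergodic theorems *)

Section transfer.
Context d d' (T : measurableType d) (T' : measurableType d') (R : realType).
Variables (m : {measure set T -> \bar R}) (m' : {measure set T' -> \bar R}) (X : T -> T').
Hypothesis mX : measurable_fun setT X.
Hypothesis mm' : forall A, measurable A -> m (X @^-1` A) = m' A.

Lemma ge0_integral_comp (f : T' -> \bar R) : measurable_fun setT f ->
  (forall x, 0 <= f x)%E -> (\int[m]_x f (X x) = \int[m']_x f x)%E.
Proof.
move=> mf f0; rewrite [RHS](eq_measure_integral (pushforward m X)).
  by rewrite [RHS]ge0_integral_pushforward // preimage_setT.
by move=> A mA _; exact/esym/mm'.
Qed.

Lemma integrable_comp (f : T' -> R) : m'.-integrable setT (EFin \o f) ->
  m.-integrable setT (EFin \o (f \o X)).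
Proof.
move=> /integrableP[mf fi]; apply/integrableP; split.
  exact: (measurableT_comp mf mX).
rewrite (le_lt_trans _ fi) //= (ge0_integral_comp (f := fun x => `|(f x)%:E|%E)) //.
exact/measurableT_comp.
Qed.

Lemma integral_comp (f : T' -> R) : m'.-integrable setT (EFin \o f) ->
  (\int[m]_x (f (X x))%:E = \int[m']_x (f x)%:E)%E.
Proof.
move=> fi; rewrite [RHS](eq_measure_integral (pushforward m X)).
  by rewrite [RHS]integral_pushforward ?preimage_setT //; [case/integrableP: fi | exact: integrable_comp].
by move=> A mA _; exact/esym/mm'.
Qed.

Lemma ae_comp (p : T' -> Prop) : {ae m', forall x, p x} -> {ae m, forall x, p (X x)}.
Proof.
move=> [N [mN N0 pN]]; exists (X @^-1` N); split.
- by rewrite -[X in measurable X]setTI; exact: mX.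
- by rewrite mm'.
- by move=> x px; apply: pN.
Qed.

End transfer.

Lemma measurable_set_le d (T : measurableType d) (R : realType) (f g : T -> R) :
  measurable_fun setT f -> measurable_fun setT g -> measurable [set x | f x <= g x].
Proof.
move=> mf mg; have := measurable_fun_ler mf mg measurableT (Y := [set true]).
by rewrite setTI; apply.
Qed.

Lemma measurable_set_lt d (T : measurableType d) (R : realType) (f g : T -> R) :
  measurable_fun setT f -> measurable_fun setT g -> measurable [set x | f x < g x].
Proof.
move=> mf mg; have := measurable_fun_ltr mf mg measurableT (Y := [set true]).
by rewrite setTI; apply.
Qed.

Lemma ge0_integrable d (T : measurableType d) (R : realType) (m : {measure set T -> \bar R})
    (f : T -> R) : measurable_fun setT f -> (forall x, 0 <= f x) ->
  (\int[m]_x (f x)%:E < +oo)%E -> m.-integrable setT (EFin \o f).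
Proof.
move=> mf f0 fi; apply/integrableP; split; first exact/measurable_EFinP.
rewrite (le_lt_trans _ fi) //= le_eqVlt; apply/orP; left; apply/eqP.
by apply: eq_integral => x _; rewrite /= ger0_norm.
Qed.

Lemma dominated_cvg_integral d (T : measurableType d) (R : realType)
    (m : {measure set T -> \bar R}) (f_ : nat -> T -> R) (f g : T -> R) :
  (forall n, measurable_fun setT (f_ n)) -> measurable_fun setT f ->
  {ae m, forall x, f_ n x @[n --> \oo] --> f x} ->
  m.-integrable setT (EFin \o g) ->
  (forall n x, `|f_ n x| <= g x) ->
  (\int[m]_x (f_ n x)%:E)%E @[n --> \oo] --> (\int[m]_x (f x)%:E)%E.
Proof.
move=> mf_ mf f_f ig fg.
have [] := @dominated_convergence _ _ _ m setT measurableT (fun n => EFin \o f_ n)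
  (EFin \o f) (EFin \o g) _ _ _ ig _ => //.
- by move=> n; exact/measurable_EFinP.
- exact/measurable_EFinP.
- move: f_f; apply: filterS => x fx _; apply: cvg_EFin fx; exact: nearW.
- by apply: aeW => x n _; rewrite /= lee_fin.
Qed.

Section almost_everywhere.
Context d (T : measurableType d) (R : realType) (m : {measure set T -> \bar R}).
Implicit Types p q r : T -> Prop.

Lemma ae_imp p q : (forall x, p x -> q x) -> {ae m, forall x, p x} -> {ae m, forall x, q x}.
Proof. by move=> pq; apply: filterS. Qed.

Lemma ae_imp2 p q r : (forall x, p x -> q x -> r x) ->
  {ae m, forall x, p x} -> {ae m, forall x, q x} -> {ae m, forall x, r x}.
Proof. by move=> pqr; apply: filterS2. Qed.

Lemma ae_countable (I : countType) (p : I -> T -> Prop) :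
  (forall i, {ae m, forall x, p i x}) -> {ae m, forall x, forall i, p i x}.
Proof.
move=> pi; have : {ae m, forall x, forall n, forall i, unpickle n = Some i -> p i x}.
  apply: ae_foralln => n; case E : (unpickle n) => [i|]; last exact: aeW.
  by apply: ae_imp (pi i) => x px j [<-].
by apply: ae_imp => x px i; exact: (px (pickle i) i (pickleK i)).
Qed.

End almost_everywhere.

Section measure_preserving.
Context d (T : measurableType d) (R : realType) (Q : probability T R) (th : T -> T).
Hypothesis mth : measurable_fun setT th.
Hypothesis Qth : forall A, measurable A -> Q (th @^-1` A) = Q A.

Lemma measurable_iter n : measurable_fun setT (iter n th).
Proof. by elim: n => [|n IH] /=; [exact: measurable_id|exact: (measurableT_comp mth)]. Qed.

Lemma iter_preserves n A : measurable A -> Q (iter n th @^-1` A) = Q A.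
Proof.
elim: n A => [//|n IH] A mA /=.
rewrite -[RHS](Qth mA) -[RHS](IH (th @^-1` A)) //.
by rewrite -[X in measurable X]setTI; exact: mth.
Qed.

Section maximal.
Variable h : T -> R.
Hypothesis ih : Q.-integrable setT (EFin \o h).

Let mh : measurable_fun setT h.
Proof. by apply/measurable_EFinP; case/integrableP: ih. Qed.

(** The maximum of 0 and the first [n] partial sums from [x], written as a recursion through [th x]
    because the maximal argument compares values at [x] and at [th x]. *)
Fixpoint run_max (n : nat) (x : T) : R :=
  if n is n'.+1 then Num.max 0 (h x + run_max n' (th x)) else 0.

Definition birkhoff_sum (n : nat) (x : T) : R := \sum_(j < n) h (iter j th x).

Lemma birkhoff_sumS n x : birkhoff_sum n.+1 x = h x + birkhoff_sum n (th x).
Proof.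
rewrite /birkhoff_sum big_ord_recl /=; congr (_ + _).
by apply: eq_bigr => i _; rewrite /bump /= -iterSr.
Qed.

Lemma measurable_birkhoff_sum n : measurable_fun setT (birkhoff_sum n).
Proof.
apply: measurable_sum => i; exact: (measurableT_comp mh (measurable_iter i)).
Qed.

Lemma run_max_ge0 n x : 0 <= run_max n x.
Proof. by case: n => //= n; rewrite le_max lexx. Qed.

Lemma run_max_le n x : run_max n x <= run_max n.+1 x.
Proof.
elim: n x => [|n IH] x; first exact: (run_max_ge0 1).
rewrite -[run_max n.+1 x]/(Num.max 0 _) -[run_max n.+2 x]/(Num.max 0 _).
by rewrite ge_max le_max lexx /= le_max lerD2l IH orbT.
Qed.

Lemma run_max_homo x : {homo run_max^~ x : m n / (m <= n)%N >-> m <= n}.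
Proof. by apply: homo_leq => //; [exact: le_trans|move=> n; exact: run_max_le]. Qed.

Lemma birkhoff_sum_le_run_max n x : birkhoff_sum n x <= run_max n x.
Proof.
elim: n x => [|n IH] x; first by rewrite /birkhoff_sum big_ord0.
by rewrite birkhoff_sumS /= le_max lerD2l IH orbT.
Qed.

Lemma integrable_run_max n : Q.-integrable setT (EFin \o run_max n).
Proof.
elim: n => [|n IH]; first exact: integrable0.
have IHth := integrable_comp mth Qth IH.
apply: (le_integrable measurableT _ _ (integrable_abse (integrableD measurableT ih IHth))).
  apply/measurable_EFinP; apply: measurable_maxr => //; apply: measurable_funD => //.
  by apply/measurable_EFinP; case/integrableP: IHth.
move=> x _ /=; rewrite lee_fin ger0_norm ?le_max ?lexx //.
by rewrite ger0_norm // ge_max normr_ge0 ler_norm.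
Qed.

Definition bounded_sums : set T := [set x | exists C : nat, forall n, birkhoff_sum n x <= C%:R].

Lemma measurable_bounded_sums : measurable bounded_sums.
Proof.
have -> : bounded_sums = \bigcup_(C : nat) \bigcap_(n : nat) [set x | birkhoff_sum n x <= C%:R].
  apply/seteqP; split => x; first by move=> [C hC]; exists C => // n _; exact: hC.
  by move=> [C _ hC]; exists C => n; exact: hC.
apply: bigcupT_measurable => C; apply: bigcapT_measurable => n.
apply: measurable_set_le => //; exact: measurable_birkhoff_sum.
Qed.

(* The recursion [M_{n+1} = max(0, h + M_n o th)] and stationarity give
   [0 <= E (M_{n+1} - M_n o th) = E max(- M_n o th, h)], which tends to [E h]
   where the sums are unbounded. *)
Lemma bounded_sums_ae : (\int[Q]_x (h x)%:E < 0)%E ->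
  Q bounded_sums = 0%E \/ Q bounded_sums = 1%E ->
  {ae Q, forall x, exists C : nat, forall n, birkhoff_sum n x <= C%:R}.
Proof.
move=> h_lt0 [Qb0|Qb1]; last first.
  exists (~` bounded_sums); split => //; first exact/measurableC/measurable_bounded_sums.
  by rewrite probability_setC ?Qb1 ?subee //; exact: measurable_bounded_sums.
exfalso; move: h_lt0; apply/negP; rewrite -leNgt.
pose D n x := Num.max (- run_max n (th x)) (h x).
have DE n x : D n x = run_max n.+1 x - run_max n (th x).
  by rewrite /D /= addr_maxl sub0r addrK.
have iMth n := integrable_comp mth Qth (integrable_run_max n).
have iD n : Q.-integrable setT (EFin \o D n).
  apply: (eq_integrable measurableT ((EFin \o run_max n.+1) \- (EFin \o (run_max n \o th)))%E).
    by move=> x _; rewrite /= DE.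
  exact: integrableB (integrable_run_max _) (iMth n).
have D0 n : (0 <= \int[Q]_x (D n x)%:E)%E.
  under eq_integral do rewrite DE EFinB.
  rewrite (integralB measurableT (integrable_run_max n.+1) (iMth n)).
  rewrite sube_ge0 ?(integral_comp mth Qth (integrable_run_max n)); last first.
    by apply/orP; right; exact: integrable_fin_num (integrable_run_max _).
  apply: le_integral => //; [exact: integrable_run_max..|].
  by move=> x _; rewrite lee_fin run_max_le.
suff cv : ((fun n => \int[Q]_x (D n x)%:E) @ \oo --> \int[Q]_x (h x)%:E)%E.
  rewrite -(cvg_lim _ cv) //; apply: lime_ge; first by apply/cvg_ex; eexists; exact: cv.
  exact: nearW.
apply: (dominated_cvg_integral (g := fun x => `|h x|) _ mh _ (integrable_norm ih)).
- by move=> n; apply/measurable_EFinP; case/integrableP: (iD n).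
- exists bounded_sums; split => //; first exact: measurable_bounded_sums.
  move=> x; apply: contra_notP => unb.
  (* Otherwise [run_max n (th x)] always stays below [- h x], hence below the absolute value of
     [h x], and this bounds all sums from [x]. *)
  have [n0 hn0] : exists n, - h x <= run_max n (th x).
    apply: contrapT => /forallNP hn; apply: unb.
    have C0 : 0 <= h x + `|h x| by rewrite -lerBlDl sub0r ler_normr lexx orbT.
    exists (Num.truncn (h x + `|h x|)).+1 => n; apply: (@le_trans _ _ (h x + `|h x|)); last first.
      exact/ltW/truncnS_gt.
    apply: le_trans (birkhoff_sum_le_run_max _ _) _.
    case: n => [//|n] /=; rewrite ge_max C0 lerD2l.
    have /negP := hn n; rewrite -ltNge => /ltW/le_trans; apply.
    by rewrite ler_normr lexx orbT.
  apply: cvg_near_cst; exists n0 => // n /= n0n.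
  rewrite /D; apply/max_idPr; rewrite lerNl.
  exact: le_trans hn0 (run_max_homo _ n0n).
(* Domination by the absolute value of [h]: [D n] equals [h] where [h] is nonnegative and lies
   between [h] and 0 elsewhere. *)
move=> n x; rewrite /D.
have [hx|hx] := leP 0 (h x).
  by rewrite (max_idPr _) // (le_trans _ hx) // oppr_le0 run_max_ge0.
have d0 : Num.max (- run_max n (th x)) (h x) <= 0.
  by rewrite ge_max oppr_le0 run_max_ge0 ltW.
by rewrite (ler0_norm d0) (ltr0_norm hx) lerN2 le_max lexx orbT.
Qed.

End maximal.
End measure_preserving.

(** * A mean inequality for subadditive processes with an invariant random rate *)

Section subadditive.
Context d (T : measurableType d) (R : realType) (Q : probability T R) (th : T -> T).
Hypothesis mth : measurable_fun setT th.
Hypothesis Qth : forall A, measurable A -> Q (th @^-1` A) = Q A.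
Variables (a : nat -> T -> R) (r : T -> R) (mu : R).
Hypothesis ma : forall n, measurable_fun setT (a n).
Hypothesis a_ge0 : forall n x, 0 <= a n x.
Hypothesis a0 : forall x, a 0 x = 0.
Hypothesis a_subadd : forall m n x, a (m + n)%N x <= a m x + a n (iter m th x).
Hypothesis a1_fin : (\int[Q]_x (a 1 x)%:E < +oo)%E.
Hypothesis mr : measurable_fun setT r.
Hypothesis r_ge0 : forall x, 0 <= r x.
Hypothesis r_inv : forall x, r (th x) = r x.
Hypothesis ae_good : {ae Q, forall x, exists2 n, (0 < n)%N & a n x <= n%:R * r x}.
Hypothesis mean_ge : forall n, ((n%:R * mu)%:E <= \int[Q]_x (a n x)%:E)%E.

Let bad N : set T := [set x | forall n, (0 < n <= N)%N -> n%:R * r x < a n x].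

Let mbad N : measurable (bad N).
Proof.
have -> : bad N = \bigcap_(n in [set n | (0 < n <= N)%N]) [set x | n%:R * r x < a n x].
  by apply/seteqP; split => x h n; exact: h.
apply: bigcap_measurableType => n _; apply: measurable_set_lt => //.
exact: measurable_funM.
Qed.

(** One forced unit step, charged only where no jump of length at most [N] is cheap. *)
Let b N x := a 1 x * \1_(bad N) x.

Let mb N : measurable_fun setT (b N).
Proof. by apply: measurable_funM => //; exact: measurable_indic. Qed.

Let b_ge0 N x : 0 <= b N x.
Proof. by rewrite mulr_ge0. Qed.

(** Within distance [N] of the target a good jump could overshoot, so unit steps finish the way: the
    summand is present exactly when [M - N <= k < M]. *)
Let late (N M : nat) x := \sum_(k < M) (M <= k + N)%:R * a 1 (iter k th x).

Let late_shift N n M x : late N M (iter n th x) <= late N (n + M) x.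
Proof.
rewrite /late big_split_ord /= -[leLHS]add0r; apply: lerD.
  by apply: sumr_ge0 => i _; rewrite mulr_ge0.
by apply: ler_sum => i _; rewrite -iterD (addnC i n) -addnA leq_add2l.
Qed.

Let bsum_shift N n M x :
  \sum_(k < n) b N (iter k th x) + \sum_(k < M) b N (iter k th (iter n th x)) =
  \sum_(k < n + M) b N (iter k th x).
Proof.
rewrite big_split_ord /=; congr (_ + _).
by apply: eq_bigr => i _; rewrite -iterD addnC.
Qed.

Let r_iter n x : r (iter n th x) = r x.
Proof. by elim: n => //= n IH; rewrite r_inv. Qed.

(* Starting from [0], jump by a good length [n <= N] of cost at most [n r], or by
   a single step when no such length exists. *)
Let jump N M x :
  a M x <= M%:R * r x + \sum_(k < M) b N (iter k th x) + late N M x.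
Proof.
elim/ltn_ind: M x => M IH x.
have bs m y : 0 <= \sum_(k < m) b N (iter k th y) by exact: sumr_ge0.
have [MN|NM] := leqP M N.
  (* For [M <= N] every position is late, and unit steps alone give the bound. *)
  rewrite -[leLHS]add0r; apply: lerD; first by rewrite addr_ge0 // mulr_ge0.
  have -> : late N M x = \sum_(k < M) a 1 (iter k th x).
    by apply: eq_bigr => k _; rewrite (leq_trans MN (leq_addl _ _)) mul1r.
  elim: (M) => [|m IHm]; first by rewrite a0 big_ord0.
  rewrite big_ord_recr /= -addn1; apply: le_trans (a_subadd _ _ _) _.
  by rewrite lerD2r.
(* A first jump of length [k] at acceptable cost; the induction hypothesis handles the remaining
   [M - k] from the shifted point, where invariance keeps the rate [r]. *)
have step k : (0 < k <= M)%N -> a k x <= k%:R * r x + \sum_(i < k) b N (iter i th x) ->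
    a M x <= M%:R * r x + \sum_(i < M) b N (iter i th x) + late N M x.
  move=> /andP[k0 kM] ak; rewrite -(subnKC kM).
  apply: le_trans (a_subadd _ _ _) _.
  have MkM : (M - k < M)%N by rewrite ltn_subrL k0 (leq_ltn_trans _ NM).
  have IHk := IH _ MkM (iter k th x); rewrite r_iter in IHk.
  apply: le_trans (lerD ak IHk) _.
  rewrite -bsum_shift natrD mulrDl.
  have := late_shift N k (M - k) x.
  set A := _ * r x; set B := _ * r x; set C := \sum_(_ < _) _; set D := \sum_(_ < _) _.
  move=> le1; rewrite [leLHS](_ : _ = A + B + (C + D) + late N (M - k) (iter k th x)).
    by rewrite lerD2l.
  by rewrite !addrA; congr (_ + _ + _); rewrite addrAC.
have [xb|/existsNP[k /not_implyP[kN /negP]]] := pselect (bad N x).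
  apply: (step 1%N); first by rewrite (leq_ltn_trans _ NM).
  rewrite big_ord1 /= /b indicE mem_set // mulr1 lerDr mulr_ge0 //.
rewrite -leNgt => ak; apply: (step k); first by case/andP: kN => -> /leq_trans ->//; exact: ltnW.
by rewrite (le_trans ak) // lerDl.
Qed.

Let ia1 : Q.-integrable setT (EFin \o a 1).
Proof. exact: ge0_integrable. Qed.

Let ib N : Q.-integrable setT (EFin \o b N).
Proof.
apply: (le_integrable measurableT _ _ ia1); first exact/measurable_EFinP.
move=> x _; rewrite /= lee_fin !ger0_norm // /b indicE.
by case: (_ \in _); rewrite ?mulr1 ?mulr0.
Qed.

(** Almost every point has a good length, so [b N x] vanishes once [N] reaches it; [a 1]
    dominates. *)
Let b_cvg0 : (\int[Q]_x (b N x)%:E)%E @[N --> \oo] --> 0%E.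
Proof.
rewrite -(integral0 Q setT).
apply: (dominated_cvg_integral (f := cst 0) _ _ _ ia1) => //.
- move: ae_good => [A [mA A0 goodA]]; exists A; split => // x; apply: contra_notP.
  move=> xA; have [n n0 an] : exists2 n, (0 < n)%N & a n x <= n%:R * r x.
    by apply: contrapT => h; apply: xA; apply: goodA.
  apply: cvg_near_cst; exists n => // N /= nN; rewrite /b indicE memNset ?mulr0 //.
  by move=> /(_ n); rewrite n0 nN => /(_ isT); rewrite ltNge an.
- move=> N x; rewrite ger0_norm // /b indicE.
  by case: (_ \in _); rewrite ?mulr1 ?mulr0.
Qed.

(** The number of late positions is bounded independently of [M], so their cost disappears after
    division by [M]. *)
Let late_count N M : (\sum_(k < M) (M <= k + N) <= minn M N)%N.
Proof.
elim: M => [|M IH]; first by rewrite big_ord0.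
rewrite big_ord_recl add0n.
under eq_bigr do rewrite lift0 addSn ltnS.
apply: (leq_trans (leq_add (leqnn _) IH)).
case: ltnP => MN; first by rewrite add1n leq_min leqnn MN.
by rewrite add0n leq_min leqnn andbT (leq_trans MN).
Qed.

(** Integrating the jump bound and using stationarity gives [M mu <= M rho + M be N + N al]. Divide
    by [M], then let [M] and afterwards [N] tend to infinity. *)
Lemma subadditive_mean_le : (mu%:E <= \int[Q]_x (r x)%:E)%E.
Proof.
have [rfin|] := ltP (\int[Q]_x (r x)%:E)%E +oo%E; last by rewrite leye_eq => /eqP ->; rewrite leey.
have ir : Q.-integrable setT (EFin \o r) by exact: ge0_integrable.
have [al alE] : exists al, (\int[Q]_x (a 1 x)%:E)%E = al%:E.
  by exists (fine (\int[Q]_x (a 1 x)%:E)%E); rewrite fineK //; exact: integrable_fin_num ia1.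
have [rho rhoE] : exists rho, (\int[Q]_x (r x)%:E)%E = rho%:E.
  by exists (fine (\int[Q]_x (r x)%:E)%E); rewrite fineK //; exact: integrable_fin_num ir.
have [be beE] : exists be : nat -> R, forall N, (\int[Q]_x (b N x)%:E)%E = (be N)%:E.
  by exists (fun N => fine (\int[Q]_x (b N x)%:E)%E) => N; rewrite fineK //; exact: integrable_fin_num (ib N).
have al0 : 0 <= al by rewrite -lee_fin -alE; apply: integral_ge0 => x _; rewrite lee_fin.
have meanM N M : M%:R * mu <= M%:R * rho + M%:R * be N + N%:R * al.
  rewrite -lee_fin; apply: le_trans (mean_ge M) _.
  have mit k := measurable_iter mth k.
  have inv k A := @iter_preserves _ _ _ Q _ mth Qth k A.
  have ile : (\int[Q]_x (a M x)%:E <= \int[Q]_x ((M%:R * r x)%:E + (\sum_(k < M) (b N (iter k th x))%:E +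
       \sum_(k < M) ((M <= k + N)%:R * a 1 (iter k th x))%:E)))%E.
    apply: ge0_le_integral => //.
    - by move=> x _; rewrite lee_fin.
    - exact/measurable_EFinP.
    - apply: emeasurable_funD; first by apply/measurable_EFinP; exact: measurable_funM.
      apply: emeasurable_funD; apply: emeasurable_sum => k; apply/measurable_EFinP.
        exact: (measurableT_comp (mb N)).
      apply: measurable_funM => //; exact: (measurableT_comp (ma 1)).
    - by move=> x _; rewrite !sumEFin -!EFinD lee_fin addrA jump.
  apply: le_trans ile _.
  rewrite ge0_integralD //; first last.
  - apply: emeasurable_funD; apply: emeasurable_sum => k; apply/measurable_EFinP.
      exact: (measurableT_comp (mb N)).
    apply: measurable_funM => //; exact: (measurableT_comp (ma 1)).
  - by move=> x _; apply: adde_ge0; apply: sume_ge0 => k _; rewrite lee_fin // mulr_ge0.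
  - by apply/measurable_EFinP; exact: measurable_funM.
  - by move=> x _; rewrite lee_fin mulr_ge0.
  rewrite ge0_integralD //; first last.
  - apply: emeasurable_sum => k; apply/measurable_EFinP.
    apply: measurable_funM => //; exact: (measurableT_comp (ma 1)).
  - by move=> x _; apply: sume_ge0 => k _; rewrite lee_fin // mulr_ge0.
  - by apply: emeasurable_sum => k; apply/measurable_EFinP; exact: (measurableT_comp (mb N)).
  - by move=> x _; apply: sume_ge0 => k _; rewrite lee_fin.
  rewrite !ge0_integral_sum //; first last.
  - by move=> k x _; rewrite lee_fin.
  - by move=> k; apply/measurable_EFinP; exact: (measurableT_comp (mb N)).
  - by move=> k x _; rewrite lee_fin mulr_ge0.
  - by move=> k; apply/measurable_EFinP; apply: measurable_funM => //; exact: (measurableT_comp (ma 1)).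
  under [X in (_ + (_ + X) <= _)%E]eq_bigr => k _.
    under eq_integral do rewrite EFinM.
    rewrite ge0_integralZl_EFin //; last 2 first.
      by move=> x _; rewrite lee_fin.
      by apply/measurable_EFinP; exact: (measurableT_comp (ma 1)).
    rewrite (ge0_integral_comp (mit k) (inv k) (f := EFin \o a 1)); last 2 first.
      exact/measurable_EFinP.
      by move=> x; rewrite lee_fin.
    rewrite alE -EFinM; over.
  under [X in (_ + (X + _) <= _)%E]eq_bigr => k _.
    rewrite (ge0_integral_comp (mit k) (inv k) (f := EFin \o b N)); last 2 first.
      exact/measurable_EFinP.
      by move=> x; rewrite lee_fin.
    rewrite beE; over.
  under eq_integral do rewrite EFinM.
  rewrite ge0_integralZl_EFin //; last 2 first.
    by move=> x _; rewrite lee_fin.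
    exact/measurable_EFinP.
  rewrite rhoE !sumEFin -EFinM -!EFinD lee_fin -addrA lerD2l.
  apply: lerD; first by rewrite sumr_const card_ord mulr_natl.
  rewrite -mulr_suml ler_wpM2r // -natr_sum ler_nat.
  exact: leq_trans (late_count _ _) (geq_minr _ _).
have mube N : mu <= rho + be N.
  rewrite leNgt; apply/negP => lt1.
  have gap : 0 < mu - (rho + be N) by rewrite subr_gt0.
  (* Large enough that [M] times the gap exceeds the boundary cost [N al]. *)
  pose M := (Num.truncn (N%:R * al / (mu - (rho + be N)))).+1.
  have := meanM N M; apply/negP; rewrite -ltNge -mulrDr addrC -ltrBrDr -mulrBr.
  by rewrite -ltr_pdivrMr // truncnS_gt.
rewrite rhoE lee_fin -subr_le0.
have be0 : be @ \oo --> 0.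
  have -> : be = fine \o (fun N => \int[Q]_x (b N x)%:E)%E by apply/funext => N /=; rewrite beE.
  exact: fine_cvg b_cvg0.
rewrite -(cvg_lim _ be0) //; apply: limr_ge; first by apply/cvg_ex; exists 0.
by apply: nearW => N; rewrite lerBlDl.
Qed.

End subadditive.

(** * Lattice paths *)

Definition is_path (u v : vertex) (p : seq vertex) : bool := path adj u p && (last u p == v).

Definition path_edges (u : vertex) (p : seq vertex) : seq edge :=
  [seq edge_of ab.1 ab.2 | ab <- zip (u :: p) p].

Definition shift_edge (v : vertex) (e : edge) : edge := ((e.1.1 + v.1, e.1.2 + v.2), e.2).

Definition shift_vertex (v u : vertex) : vertex := (u.1 + v.1, u.2 + v.2).

Lemma shift_edge_comp (v w : vertex) (e : edge) :
  shift_edge v (shift_edge w e) = shift_edge (shift_vertex v w) e.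
Proof. by rewrite /shift_edge /= !addrA. Qed.

Lemma shift_edge0 (e : edge) : shift_edge (0, 0) e = e.
Proof. by case: e => [[x y] b]; rewrite /shift_edge /= !addr0. Qed.

Lemma shift_edge_inj (v : vertex) : injective (shift_edge v).
Proof. by move=> [[x y] b] [[x' y'] b']; rewrite /shift_edge => -[] /addIr -> /addIr -> ->. Qed.

Lemma shift_vertex_inj (v : vertex) : injective (shift_vertex v).
Proof. by move=> [x y] [x' y']; rewrite /shift_vertex => -[] /addIr -> /addIr ->. Qed.

Lemma adj_shift (v a b : vertex) : adj (shift_vertex v a) (shift_vertex v b) = adj a b.
Proof.
have h (x y z : int) : x + z - (y + z) = x - y by rewrite opprD addrACA subrr addr0.
by rewrite /adj /= !h.
Qed.

Lemma edge_of_shift (v a b : vertex) :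
  edge_of (shift_vertex v a) (shift_vertex v b) = shift_edge v (edge_of a b).
Proof.
rewrite /edge_of /= (inj_eq (addIr _)); case: ifP => _; rewrite /shift_edge /=.
  by rewrite addr_minl.
by rewrite addr_minl.
Qed.

Lemma path_edges_cons u x p : path_edges u (x :: p) = edge_of u x :: path_edges x p.
Proof. by []. Qed.

Lemma path_edges_cat u p q :
  path_edges u (p ++ q) = path_edges u p ++ path_edges (last u p) q.
Proof. by elim: p u => [//|x p IH] u; rewrite cat_cons !path_edges_cons IH. Qed.

Lemma path_edges_shift v u p :
  path_edges (shift_vertex v u) (map (shift_vertex v) p) = map (shift_edge v) (path_edges u p).
Proof.
elim: p u => [//|x p IH] u; rewrite map_cons !path_edges_cons map_cons.
by rewrite edge_of_shift -IH.
Qed.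

Lemma is_path_shift v u z p :
  is_path (shift_vertex v u) (shift_vertex v z) (map (shift_vertex v) p) = is_path u z p.
Proof.
rewrite /is_path last_map (inj_eq (@shift_vertex_inj v)); congr (_ && _).
by elim: p u => [//|x p IH] u; rewrite map_cons /= adj_shift IH.
Qed.

Lemma is_path_cat u v z p q : is_path u v p -> is_path v z q -> is_path u z (p ++ q).
Proof.
move=> /andP[pp /eqP pl] /andP[qp ql].
by rewrite /is_path cat_path last_cat pl pp qp ql.
Qed.

(** Walk horizontally, then vertically. It serves twice: for the existence of paths, and for finite
    families of paths whose minimum is integrable. *)
Lemma lattice_ind (S : vertex -> vertex -> Prop) :
  (forall u, S u u) -> (forall u v w, S u v -> S v w -> S u w) ->
  (forall u v, adj u v -> S u v) -> forall u v, S u v.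
Proof.
move=> S0 St S1 u v.
have horiz n (x y : int) : S (x, y) (x + n%:Z, y) /\ S (x + n%:Z, y) (x, y).
  elim: n => [|n [IH1 IH2]]; first by rewrite addr0; split.
  have a1 : adj (x + n%:Z, y) (x + n.+1%:Z, y) /\ adj (x + n.+1%:Z, y) (x + n%:Z, y).
    by rewrite /adj /= subrr; split; apply/eqP; lia.
  by split; [apply: St IH1 (S1 _ _ a1.1)|apply: St (S1 _ _ a1.2) IH2].
have vert n (x y : int) : S (x, y) (x, y + n%:Z) /\ S (x, y + n%:Z) (x, y).
  elim: n => [|n [IH1 IH2]]; first by rewrite addr0; split.
  have a1 : adj (x, y + n%:Z) (x, y + n.+1%:Z) /\ adj (x, y + n.+1%:Z) (x, y + n%:Z).
    by rewrite /adj /= subrr; split; apply/eqP; lia.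
  by split; [apply: St IH1 (S1 _ _ a1.1)|apply: St (S1 _ _ a1.2) IH2].
case: u v => [x y] [x' y']; apply: (St _ (x', y)).
  have [le|le] := leP x x'.
    have -> : x' = x + `|x' - x|%N%:Z by lia.
    exact: (horiz _ _ _).1.
  have {1}-> : x = x' + `|x - x'|%N%:Z by lia.
  exact: (horiz _ _ _).2.
have [le|le] := leP y y'.
  have -> : y' = y + `|y' - y|%N%:Z by lia.
  exact: (vert _ _ _).1.
have {1}-> : y = y' + `|y - y'|%N%:Z by lia.
exact: (vert _ _ _).2.
Qed.

Lemma exists_path u v : exists p, is_path u v p.
Proof.
apply: (lattice_ind (S := fun u v => exists p, is_path u v p)) => {u v} [u|u v w [p pp] [q qq]|u v uv].
- by exists [::]; rewrite /is_path /=.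
- by exists (p ++ q); exact: is_path_cat pp qq.
- by exists [:: v]; rewrite /is_path /= uv /=.
Qed.

Section times.
Context {R : realType}.
Implicit Types w : edge -> R.

Lemma path_timeE w u p : path_time w u p = \sum_(e <- path_edges u p) w e.
Proof. by rewrite /path_time /path_edges big_map. Qed.

Lemma path_time_cat w u p q :
  path_time w u (p ++ q) = path_time w u p + path_time w (last u p) q.
Proof. by rewrite !path_timeE path_edges_cat big_cat. Qed.

Lemma path_time_shift w v u p :
  path_time w (shift_vertex v u) (map (shift_vertex v) p) = path_time (w \o shift_edge v) u p.
Proof. by rewrite !path_timeE path_edges_shift big_map. Qed.

Lemma path_time_ge0 w u p : (forall e, 0 <= w e) -> 0 <= path_time w u p.
Proof. by move=> w0; rewrite path_timeE sumr_ge0. Qed.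

Lemma le_path_time w w' u p : (forall e, w e <= w' e) -> path_time w u p <= path_time w' u p.
Proof. by move=> ww'; rewrite !path_timeE; apply: ler_sum. Qed.

(** The starting value of the minimum is the time of the first listed path, so for a nonempty list
    nothing foreign enters. Such a minimum involves only finitely many edges, unlike the infimum. *)
Definition min_time w u (s : seq (seq vertex)) : R :=
  \big[Num.min/path_time w u (head [::] s)]_(p <- s) path_time w u p.

Definition route (u v : vertex) (s : seq (seq vertex)) : bool :=
  (s != [::]) && all (is_path u v) s.

Lemma min_time_le w u s p : p \in s -> min_time w u s <= path_time w u p.
Proof.
rewrite /min_time; elim: s (path_time _ _ _) => //= q s IH t0.
rewrite inE big_cons ge_min => /orP[/eqP ->|/IH ->]; first by rewrite lexx.
by rewrite orbT.
Qed.

Lemma min_timeP w u s : s != [::] -> exists2 p, p \in s & min_time w u s = path_time w u p.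
Proof.
move=> s0; rewrite /min_time; set t0 := head _ _.
have t0s : t0 \in s by rewrite /t0; case: (s) s0 => // a b _; rewrite mem_head.
suff : forall r, {subset r <= s} -> exists2 p, p \in s &
    \big[Num.min/path_time w u t0]_(q <- r) path_time w u q = path_time w u p by apply.
elim => [|q r IH] rs; first by exists t0; rewrite ?big_nil.
have [//|p ps pE] := IH; first by move=> x xr; apply: rs; rewrite inE xr orbT.
rewrite big_cons pE minEle; case: ifP => _; last by exists p.
by exists q => //; apply: rs; rewrite mem_head.
Qed.

Lemma le_min_time w w' u s : (forall e, w e <= w' e) -> min_time w u s <= min_time w' u s.
Proof.
have [->|s0] := eqVneq s [::].
  by move=> ?; rewrite /min_time !big_nil le_path_time.
move=> ww'; have [p ps ->] := min_timeP w' u s0.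
exact: le_trans (min_time_le _ _ ps) (le_path_time _ _ ww').
Qed.

Lemma min_time_ge0 w u s : (forall e, 0 <= w e) -> 0 <= min_time w u s.
Proof.
move=> w0; have [->|s0] := eqVneq s [::]; first by rewrite /min_time big_nil path_time_ge0.
by have [p _ ->] := min_timeP w u s0; exact: path_time_ge0.
Qed.

Lemma eq_min_time w w' u s :
  {in flatten (map (path_edges u) s), w =1 w'} -> min_time w u s = min_time w' u s.
Proof.
move=> ww'; have ptE p : p \in s -> path_time w u p = path_time w' u p.
  move=> ps; rewrite !path_timeE; apply: eq_big_seq => e ep; apply: ww'.
  by apply/flattenP; exists (path_edges u p) => //; exact: map_f.
rewrite /min_time (eq_big_seq _ ptE); case: s ptE {ww'} => [|p s] ptE; first by rewrite !big_nil !path_timeE /path_edges /= !big_nil.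
by rewrite /= ptE ?mem_head.
Qed.

Section passage.
Variable w : edge -> R.
Hypothesis w_ge0 : forall e, 0 <= w e.

Let times u v := [set t : R | exists p : seq vertex,
         [/\ path adj u p, last u p = v & t = path_time w u p]].

Let times_lb u v : lbound (times u v) 0.
Proof. by move=> _ [p [_ _ ->]]; exact: path_time_ge0. Qed.

Let times_has_inf u v : has_inf (times u v).
Proof.
split; last by exists 0; exact: times_lb.
have [p /andP[pp /eqP pl]] := exists_path u v.
by exists (path_time w u p), p.
Qed.

Lemma passage_time_ge0 u v : 0 <= passage_time w u v.
Proof. by apply: lb_le_inf; [case: (times_has_inf u v)|exact: times_lb]. Qed.

Lemma passage_time_le u v p : is_path u v p -> passage_time w u v <= path_time w u p.
Proof.
move=> /andP[pp /eqP pl]; apply: ge_inf; first by case: (times_has_inf u v).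
by exists p.
Qed.

Lemma passage_time_approx u v (e : R) : 0 < e ->
  exists2 p, is_path u v p & path_time w u p < passage_time w u v + e.
Proof.
move=> e0; have [_ [p [pp pl ->]] lt] := inf_adherent e0 (times_has_inf u v).
by exists p => //; rewrite /is_path pp pl eqxx.
Qed.

Lemma passage_time_le_min_time u v s : route u v s -> passage_time w u v <= min_time w u s.
Proof.
move=> /andP[s0 /allP sp]; have [p /sp pp ->] := min_timeP w u s0.
exact: passage_time_le.
Qed.

Lemma passage_time_triangle u v z :
  passage_time w u z <= passage_time w u v + passage_time w v z.
Proof.
apply/ler_addgt0Pr => e e0.
have e20 : 0 < e / 2 by rewrite divr_gt0.
have [p pp lp] := passage_time_approx u v e20.
have [q qq lq] := passage_time_approx v z e20.
apply: le_trans (passage_time_le (is_path_cat pp qq)) _.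
rewrite path_time_cat; case/andP: pp => _ /eqP ->.
by rewrite (splitr e) addrACA; apply: lerD; exact: ltW.
Qed.

Lemma passage_time_refl u : passage_time w u u = 0.
Proof.
apply/eqP; rewrite eq_le passage_time_ge0 andbT.
have -> : 0 = path_time w u [::] by rewrite path_timeE big_nil.
by apply: passage_time_le; rewrite /is_path /=.
Qed.

End passage.

Lemma passage_time_shift w v u z :
  passage_time w (shift_vertex v u) (shift_vertex v z) = passage_time (w \o shift_edge v) u z.
Proof.
rewrite /passage_time; congr inf; apply/seteqP; split => t /= [p [pp pl ->]].
  pose v' : vertex := (- v.1, - v.2).
  have K : cancel (shift_vertex v') (shift_vertex v).
    by case=> a b; rewrite /shift_vertex /= !subrK.
  have K' : cancel (shift_vertex v) (shift_vertex v').
    by case=> a b; rewrite /shift_vertex /= !addrK.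
  exists (map (shift_vertex v') p).
  have /andP[qp /eqP ql] : is_path u z (map (shift_vertex v') p).
    rewrite -(is_path_shift v) -map_comp (eq_map (g := id)) ?map_id; last exact: K.
    by rewrite /is_path pp pl eqxx.
  split => //; rewrite -path_time_shift -map_comp (eq_map (g := id)) ?map_id //; exact: K.
exists (map (shift_vertex v) p).
have /andP[qp /eqP ql] : is_path (shift_vertex v u) (shift_vertex v z) (map (shift_vertex v) p).
  by rewrite is_path_shift /is_path pp pl eqxx.
by split => //; rewrite path_time_shift.
Qed.

Lemma le_passage_time w w' u v : (forall e, 0 <= w e) -> (forall e, w e <= w' e) ->
  passage_time w u v <= passage_time w' u v.
Proof.
move=> w0 ww'; apply/ler_addgt0Pr => e e0.
have w'0 f : 0 <= w' f by exact: le_trans (ww' f).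
have [p pp lp] := passage_time_approx w'0 u v e0.
apply: le_trans (passage_time_le w0 pp) _.
exact: le_trans (le_path_time _ _ ww') (ltW lp).
Qed.

(** Increasing finite families that exhaust all paths by their codes; the chosen first path keeps
    each of them nonempty. Measurability and means of passage times are obtained along this
    sequence. *)
Definition routes (u v : vertex) (N : nat) : seq (seq vertex) :=
  xchoose (exists_path u v) ::
  [seq p <- pmap unpickle (iota 0 N) | is_path u v p].

Lemma routesP u v N : route u v (routes u v N).
Proof.
by rewrite /route /= (xchooseP (exists_path u v)) /=; apply/allP => p; rewrite mem_filter => /andP[].
Qed.

Lemma sub_routes u v s : route u v s -> exists N, {subset s <= routes u v N}.
Proof.
move=> /andP[_ /allP sp]; exists (\max_(p <- s) (pickle p)).+1 => p ps.
rewrite inE mem_filter sp // andTb mem_pmap; apply/orP; right.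
apply/mapP; exists (pickle p); last by rewrite pickleK.
by rewrite mem_iota /= add0n ltnS (leq_bigmax_seq p).
Qed.

Lemma routes_homo u v M N : (M <= N)%N -> {subset routes u v M <= routes u v N}.
Proof.
move=> MN p; rewrite !inE !mem_filter => /orP[->//|/andP[-> pM]]; apply/orP; right; rewrite andTb.
move: pM; rewrite !mem_pmap => /mapP[i iM pi]; apply/mapP; exists i => //.
by move: iM; rewrite !mem_iota /= !add0n => /leq_trans; apply.
Qed.

Lemma sub_min_time w u s t : s != [::] -> {subset s <= t} -> min_time w u t <= min_time w u s.
Proof. by move=> s0 st; have [p /st pt ->] := min_timeP w u s0; exact: min_time_le. Qed.

Lemma min_time_routes_cvg w u v : (forall e, 0 <= w e) ->
  min_time w u (routes u v N) @[N --> \oo] --> passage_time w u v.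
Proof.
move=> w0; apply/cvgrPdist_le => e e0.
have [p pp lp] := passage_time_approx w0 u v e0.
have [N pN] : exists N, {subset [:: p] <= routes u v N}.
  by apply: sub_routes; rewrite /route /= pp.
exists N => // n /= Nn; rewrite ler0_norm; last first.
  by rewrite subr_le0; apply: passage_time_le_min_time => //; exact: routesP.
rewrite opprB lerBlDl; apply: le_trans (ltW lp).
by apply: min_time_le; apply: (routes_homo Nn); apply: pN; rewrite mem_head.
Qed.

End times.

(** * Quantile functions *)

Lemma measurable_fun_le_sets d (T : measurableType d) (R : realType) (f : T -> R) :
  (forall x, measurable [set t | f t <= x]) -> measurable_fun setT f.
Proof.
move=> mf; apply: (measurability (RGenOInfty.G (R := R)) (RGenOInfty.measurableE R)) => //.
move=> _ [_ [x ->] <-]; rewrite setTI.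
have -> : f @^-1` `]x, +oo[ = ~` [set t | f t <= x].
  by apply/seteqP; split => t /=; rewrite in_itv /= andbT => h; [apply/negP; rewrite -ltNge|move/negP: h; rewrite -ltNge].
exact: measurableC.
Qed.

Lemma measurable_ray (R : realType) (x : R) : measurable [set y : R | y <= x].
Proof. by have := @measurable_itv R `]-oo, x]; rewrite set_itvE. Qed.

Lemma probability_real_unique (R : realType) (m1 m2 : {measure set R -> \bar R}) :
  m1 setT = 1%E -> m2 setT = 1%E ->
  (forall x, m1 [set y : R | y <= x] = m2 [set y : R | y <= x]) ->
  forall A, measurable A -> m1 A = m2 A.
Proof.
move=> m11 m21 m12 A mA.
have rayE (x : R) : `]x, +oo[%classic = ~` [set y : R | y <= x].
  by apply/seteqP; split => t /=; rewrite in_itv /= andbT => h; [apply/negP; rewrite -ltNge|move/negP: h; rewrite -ltNge].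
have mray (m : {measure set R -> \bar R}) x : m setT = 1%E ->
    m (~` [set y : R | y <= x]) = (1 - m [set y : R | (y <= x)%R])%E.
  move=> mT; have mr := measurable_ray x.
  rewrite -setTD measureD //; first by congr (_ - _)%E; [exact: mT|rewrite setTI].
  by apply: (@le_lt_trans _ _ 1%E); [rewrite -mT|exact: ltry].
apply: (@g_sigma_algebra_measure_unique _ _ _ (RGenOInfty.G (R := R)) _
  (fun k => `](- k%:R)%R, +oo[%classic)).
- by move=> _ [x ->].
- by move=> k; exists (- k%:R).
- apply/seteqP; split => // x _; exists (Num.truncn `|x|).+1 => //=.
  rewrite in_itv /= andbT ltrNl (le_lt_trans _ (truncnS_gt _)) //.
  by rewrite -normrN ler_norm.
- move=> _ _ [x ->] [y ->]; exists (Num.max x y).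
  by apply/seteqP; split => t /=; rewrite !in_itv /= !andbT gt_max => /andP.
- by move=> _ [x ->]; rewrite rayE !mray ?m12.
- move=> k; apply: (@le_lt_trans _ _ 1%E); last exact: ltry.
  by rewrite -m11; apply: le_measure => //; rewrite inE.
- have e : (measurable : set (set R)) = <<s RGenOInfty.G (R := R) >> := RGenOInfty.measurableE R.
  by rewrite -e.
Qed.

Section quantile.
Context {R : realType} (mu : probability R R).
Hypothesis mu0 : supported_nonneg mu.

Let F := Defs.cdf mu.

Let FE x : mu [set y : R | y <= x] = (F x)%:E.
Proof. by rewrite /F /Defs.cdf fineK // fin_num_measure //; exact: measurable_ray. Qed.

Lemma cdf_homo : {homo Defs.cdf mu : x y / x <= y}.
Proof.
move=> x y xy; rewrite -lee_fin -!FE; apply: le_measure.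
- by rewrite inE; exact: measurable_ray.
- by rewrite inE; exact: measurable_ray.
- by move=> z /= zx; exact: le_trans zx xy.
Qed.

Lemma cdf_ge0 x : 0 <= Defs.cdf mu x.
Proof. by rewrite -lee_fin -FE. Qed.

Lemma cdf_le1 x : Defs.cdf mu x <= 1.
Proof. by rewrite -lee_fin -FE; apply: probability_le1; exact: measurable_ray. Qed.

Let F_neg x : x < 0 -> F x = 0.
Proof.
move=> x0; apply/EFin_inj; rewrite -FE; apply/eqP; rewrite eq_le measure_ge0 andbT.
have mnn : measurable [set y : R | 0 <= y] by have := @measurable_itv R `[0, +oo[; rewrite set_itvE.
have : mu (~` [set y : R | 0 <= y]) = 0%E by rewrite probability_setC // mu0 subee.
move=> m0; rewrite -[leRHS]m0; apply: le_measure.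
- by rewrite inE; exact: measurable_ray.
- by rewrite inE; exact: measurableC.
- by move=> y /= yx y0; have := lt_le_trans x0 (le_trans y0 yx); rewrite ltxx.
Qed.

Let F_nonneg u x : 0 < u -> u <= F x -> 0 <= x.
Proof. by move=> u0 uF; rewrite leNgt; apply/negP => /F_neg; move: (lt_le_trans u0 uF) => /[swap] ->; rewrite ltxx. Qed.

(** Right continuity, from continuity from above of the measure. It makes the infimum in [qf] an
    attained minimum. *)
Lemma cdf_right_limit u x : (forall n : nat, u <= Defs.cdf mu (x + n.+1%:R^-1)) -> u <= Defs.cdf mu x.
Proof.
move=> h.
pose S (n : nat) := [set y : R | y <= x + n.+1%:R^-1].
have cv : mu \o S @ \oo --> mu (\bigcap_n S n).
  apply: nonincreasing_cvg_mu.
  - by rewrite (le_lt_trans (probability_le1 _ _)) ?ltry //; exact: measurable_ray.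
  - by move=> i; exact: measurable_ray.
  - by apply: bigcapT_measurable => i; exact: measurable_ray.
  - move=> m n mn; apply/subsetPset => y /= /le_trans; apply.
    by rewrite lerD2l lef_pV2 ?posrE // ler_nat.
have SE : \bigcap_n S n = [set y : R | y <= x].
  apply/seteqP; split => y /=; last by move=> yx n _; apply: le_trans yx _; rewrite lerDl.
  move=> hy; rewrite leNgt; apply/negP => xy.
  have d0 : 0 < y - x by rewrite subr_gt0.
  pose n := Num.truncn (y - x)^-1.
  have : y <= x + n.+1%:R^-1 by exact: hy.
  rewrite leNgt => /negP; apply.
  rewrite -ltrBrDl -[ltRHS]invrK ltf_pV2 ?posrE ?invr_gt0 //.
  exact: truncnS_gt.
rewrite SE in cv; rewrite -lee_fin -FE -(cvg_lim _ cv) //; apply: lime_ge.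
  by apply/cvg_ex; eexists; exact: cv.
by apply: nearW => n /=; rewrite /S FE lee_fin; exact: h.
Qed.

Lemma qf_nonneg u : 0 <= qf mu u.
Proof.
rewrite /qf; have [u0|u0] := ltP 0 u.
  have [->|] := eqVneq [set x | u <= Defs.cdf mu x] set0; first by rewrite inf0.
  by move=> /set0P ne; apply: lb_le_inf => // x /=; exact: F_nonneg.
(* For [u <= 0] every real qualifies, the set has no lower bound, and [inf] takes its default value
   0. *)
rewrite inf_out // => -[_ [b hb]].
have := hb (b - 1) => /= /(_ (le_trans u0 (cdf_ge0 _))).
by rewrite lerBrDl gerDr ler10.
Qed.

Lemma qf_neg u : u <= 0 -> qf mu u = 0.
Proof.
move=> u0; rewrite /qf inf_out // => -[_ [b hb]].
have := hb (b - 1) => /= /(_ (le_trans u0 (cdf_ge0 _))).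
by rewrite lerBrDl gerDr ler10.
Qed.

Lemma qf_big u : 1 < u -> qf mu u = 0.
Proof.
move=> u1; rewrite /qf (_ : [set x | _] = set0) ?inf0 //.
apply/seteqP; split => // x /= ux.
by have := lt_le_trans u1 (le_trans ux (cdf_le1 x)); rewrite ltxx.
Qed.

Let cdf_reaches u : u < 1 -> exists x, u <= F x.
Proof.
move=> u1; pose S (n : nat) := [set y : R | y <= n%:R].
have cv : mu \o S @ \oo --> mu (\bigcup_n S n).
  apply: nondecreasing_cvg_mu.
  - by move=> i; exact: measurable_ray.
  - by apply: bigcupT_measurable => i; exact: measurable_ray.
  - by move=> m n mn; apply/subsetPset => y /= /le_trans; apply; rewrite ler_nat.
have SE : \bigcup_n S n = setT.
  apply/seteqP; split => // x _; exists (Num.truncn `|x|).+1 => //=.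
  by apply: le_trans (ltW (truncnS_gt _)); exact: ler_norm.
rewrite SE (_ : mu setT = 1%E) in cv; last exact: probability_setT.
apply: contrapT => /forallNP h.
have : (1%:E <= u%:E :> \bar R)%E.
  rewrite -(cvg_lim _ cv) //; apply: lime_le.
    by apply/cvg_ex; eexists; exact: cv.
  by apply: nearW => n /=; rewrite /S FE lee_fin; have /negP := h n%:R; rewrite -ltNge => /ltW.
by rewrite lee_fin leNgt u1.
Qed.

(** The Galois connection between quantile and distribution function. At [u = 1] the set may be
    empty and [inf] would default to 0, hence the open interval. *)
Lemma qf_leE u x : 0 < u < 1 -> (qf mu u <= x) = (u <= Defs.cdf mu x).
Proof.
move=> /andP[u0 u1]; have [y uy] := cdf_reaches u1.
have hi : has_inf [set x | u <= Defs.cdf mu x].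
  by split; [exists y|exists 0 => z /=; exact: F_nonneg].
apply/idP/idP => [qx|ux]; last by apply: ge_inf => //; case: hi.
apply: cdf_right_limit => n.
have n0 : 0 < n.+1%:R^-1 :> R by rewrite invr_gt0.
have [z /= uz zq] := inf_adherent n0 hi.
by apply: le_trans uz _; apply: cdf_homo; apply: le_trans (ltW zq) _; rewrite lerD2r.
Qed.

Lemma qf_homo u v : 0 < u -> u <= v -> v < 1 -> qf mu u <= qf mu v.
Proof.
move=> u0 uv v1; have v01 : 0 < v < 1 by rewrite v1 (lt_le_trans u0 uv).
rewrite qf_leE ?u0 ?(le_lt_trans uv) //; apply: le_trans uv _.
by rewrite -(qf_leE _ v01).
Qed.

Lemma measurable_qf : measurable_fun setT (qf mu).
Proof.
apply: measurable_fun_le_sets => x.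
(* The Galois connection describes the part inside []0, 1[]; at [u <= 0] and at [u > 1] the quantile
   is 0; the point 1 is handled on its own. *)
have -> : [set u | qf mu u <= x] =
    ([set` `]0, 1[%R] `&` [set u | u <= Defs.cdf mu x]) `|`
    (([set u | u <= 0] `|` [set` `]1, +oo[%R]) `&` [set _ | 0 <= x]) `|`
    ([set 1] `&` [set _ | qf mu 1 <= x]).
  apply/seteqP; split => u /=; rewrite !in_itv /=.
    move=> qx; have [u0|u0] := leP u 0.
      by left; right; split; [left|rewrite -(qf_neg u0)].
    have [u1|u1|u1] := ltgtP u 1; last by right; split; rewrite -?u1.
      have u01 : 0 < u < 1 by rewrite u0 u1.
      by left; left; split => //=; rewrite ?in_itv -?(qf_leE _ u01).
    by left; right; split; [right|rewrite -(qf_big u1)].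
  move=> [[[u01 uF]|[[u0|]]]|[->]//].
  - by rewrite qf_leE.
  - by rewrite qf_neg.
  - by rewrite andbT => /qf_big ->.
apply: measurableU; first apply: measurableU.
- by apply: measurableI => //; exact: measurable_ray.
- apply: measurableI; first by apply: measurableU => //; exact: measurable_ray.
  have [x0|x0] := boolP (0 <= x); first by rewrite (_ : [set _ | _] = setT) //; apply/seteqP; split.
  by rewrite (_ : [set _ | _] = set0) //; apply/seteqP; split.
- apply: measurableI => //.
  have [x0|x0] := boolP (qf mu 1 <= x); first by rewrite (_ : [set _ | _] = setT) //; apply/seteqP; split.
  by rewrite (_ : [set _ | _] = set0) //; apply/seteqP; split.
Qed.

Section law.
Context d (T : measurableType d) (Q : probability T R) (U : T -> R).
Hypothesis mU : measurable_fun setT U.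
Hypothesis uniformU : forall t, 0 <= t <= 1 -> Q [set w | U w <= t] = t%:E.

Lemma uniform_ae : {ae Q, forall w, 0 < U w < 1}.
Proof.
have mUle t : measurable [set w | U w <= t] by exact: measurable_set_le.
exists ([set w | U w <= 0] `|` \bigcap_(n : nat) ~` [set w | U w <= 1 - n.+1%:R^-1]); split.
- by apply: measurableU => //; apply: bigcapT_measurable => n; exact: measurableC.
- apply/null_set_setU => //.
  + by apply: bigcapT_measurable => n; exact: measurableC.
  + by apply: etrans (uniformU _) _; rewrite ?lexx ?ler01.
  + apply/eqP; rewrite eq_le measure_ge0 andbT; apply/lee_addgt0Pr => e e0.
    pose n := Num.truncn e^-1.
    have n1 : n.+1%:R^-1 <= 1 :> R by rewrite invf_le1 ?ler1n.
    apply: (@le_trans _ _ (Q (~` [set w | U w <= 1 - n.+1%:R^-1]))).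
      apply: le_measure; rewrite ?inE.
      * by apply: bigcapT_measurable => k; exact: measurableC.
      * exact: measurableC.
      * by move=> w h; exact: (h n I).
    rewrite probability_setC // uniformU; last first.
      by rewrite subr_ge0 n1 lerBlDr lerDl invr_ge0 ler0n.
    rewrite -EFinB opprB addrCA subrr addr0 add0e lee_fin.
    by rewrite -[leRHS]invrK lef_pV2 ?posrE ?invr_gt0 // ltW // truncnS_gt.
- move=> w /=; apply: contra_notP => /not_orP[/negP U0 U1]; rewrite ltNge U0 /=.
  have [n] : exists n : nat, U w <= 1 - n.+1%:R^-1.
    apply: contrapT => /forallNP h; apply: U1 => n _ /=; exact: h.
  by move=> /le_lt_trans; apply; rewrite ltrBlDr ltrDl.
Qed.

(** Inverse transform sampling. The sublevel events are compared off a null set outside of which [U]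
    lies in []0, 1[]. *)
Lemma qf_law A : measurable A -> Q ((qf mu \o U) @^-1` A) = mu A.
Proof.
have mqU : measurable_fun setT (qf mu \o U) := measurableT_comp measurable_qf mU.
have [m mE] := exists_image_measure Q mqU.
move=> mA; rewrite -mE; apply: probability_real_unique mA.
- by rewrite mE preimage_setT; exact: probability_setT.
- exact: probability_setT.
move=> x; rewrite mE; transitivity (Q [set w | U w <= F x]); last first.
  by apply: etrans (uniformU _) (esym (FE x)); rewrite cdf_ge0 cdf_le1.
have [N [mN N0 UN]] := uniform_ae.
have key B : measurable B -> Q B = Q (B `\` N).
  move=> mB; rewrite measureD //; last by rewrite (le_lt_trans (probability_le1 _ _)) ?ltry.
  rewrite [X in (_ - X)%E](_ : _ = 0%E) ?sube0 //.
  apply/eqP; rewrite eq_le measure_ge0 andbT -[leRHS]N0; apply: le_measure; rewrite ?inE //.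
  exact: measurableI.
have mqle : measurable [set w | (qf mu \o U) w <= x] by exact: measurable_set_le.
apply: etrans (key _ mqle) _.
rewrite [RHS]key; last exact: measurable_set_le.
congr (Q _); apply/seteqP; split => w /= [h wN]; split => //.
  by rewrite -qf_leE //; apply: contrapT => h'; apply: wN; exact: UN.
by rewrite qf_leE //; apply: contrapT => h'; apply: wN; exact: UN.
Qed.

End law.
End quantile.

(** * Disjoint paths and integrability *)

Definition rotate (v : vertex) : vertex := (- v.2, v.1).

(** Paths from the origin to [(1, 0)] that leave by the four different edges at the origin and
    arrive by the four different edges at the target; the last one goes around. Quarter turns
    [rotate] supply the other three directions. *)
Definition unit_paths : seq (seq vertex) :=
  [:: [:: (1, 0)];
      [:: (0, 1); (1, 1); (1, 0)];
      [:: (0, -1); (1, -1); (1, 0)];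
      [:: (-1, 0); (-1, 1); (-1, 2); (0, 2); (1, 2); (2, 2); (2, 1); (2, 0); (1, 0)]].

Lemma unit_paths_disjoint (k : nat) : (k < 4)%N ->
  let s := map (map (iter k rotate)) unit_paths in
  all (is_path origin (iter k rotate (1, 0))) s && uniq (flatten (map (path_edges origin) s)).
Proof. by case: k => [|[|[|[|//]]]] _; vm_compute. Qed.

Lemma four_disjoint_paths (u v : vertex) : adj u v -> exists s,
  [/\ size s = 4, all (is_path u v) s & uniq (flatten (map (path_edges u) s))].
Proof.
move=> uv; have [k k4 vE] : exists2 k, (k < 4)%N & v = shift_vertex u (iter k rotate (1, 0)).
  case: u v uv => [x y] [x' y']; rewrite /adj /= => uv.
  have [[h1 h2]|[[h1 h2]|[[h1 h2]|[h1 h2]]]] :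
    (x' = x + 1 /\ y' = y) \/ (x' = x /\ y' = y + 1) \/ (x' = x - 1 /\ y' = y) \/ (x' = x /\ y' = y - 1) by lia.
  - by exists 0%N => //; rewrite /shift_vertex /= h1 h2; congr pair; lia.
  - by exists 1%N => //; rewrite /shift_vertex /= h1 h2; congr pair; lia.
  - by exists 2%N => //; rewrite /shift_vertex /= h1 h2; congr pair; lia.
  - by exists 3%N => //; rewrite /shift_vertex /= h1 h2; congr pair; lia.
have /andP[pth unq] := unit_paths_disjoint k4.
have uE : u = shift_vertex u origin by case: (u) => a b; rewrite /shift_vertex /= !add0r.
exists (map (map (shift_vertex u)) (map (map (iter k rotate)) unit_paths)); split => //.
  rewrite all_map; apply: sub_all pth => p /= pp.
  by rewrite vE {1}uE is_path_shift.
rewrite -map_comp (eq_map (g := map (shift_edge u) \o path_edges origin)).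
  rewrite map_comp -map_flatten map_inj_uniq //; exact: shift_edge_inj.
by move=> p /=; rewrite {1}uE path_edges_shift.
Qed.

(** Replaces a path time by a single weight at the price of the length, so that a minimum of four
    path times compares with a minimum of four weights. *)
Lemma sum_le_max_term (R : realType) (E : seq edge) (w : edge -> R) : E != [::] ->
  exists2 e, e \in E & \sum_(x <- E) w x <= (size E)%:R * w e.
Proof.
elim: E => // e E IH _; have [->|E0] := eqVneq E [::].
  by exists e; rewrite ?mem_head // big_seq1 mul1r.
have [e' e'E le'] := IH E0; rewrite big_cons /=.
have [ee'|ee'] := leP (w e) (w e').
  exists e'; first by rewrite inE e'E orbT.
  by rewrite -natr1 mulrDl mul1r addrC lerD.
exists e; first by rewrite mem_head.
rewrite -natr1 mulrDl mul1r addrC lerD2r; apply: le_trans le' _.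
by rewrite ler_wpM2l // ltW.
Qed.

Lemma term_le_sum (R : realType) (T : eqType) (E : seq T) (F : T -> R) e :
  (forall x, 0 <= F x) -> e \in E -> F e <= \sum_(x <- E) F x.
Proof. by move=> F0 eE; rewrite (big_rem e) //= lerDl sumr_ge0. Qed.

Definition min4 {R : realType} (g : 'I_4 -> R) : R := \big[Num.min/g ord0]_(i < 4) g i.

Lemma min4_le {R : realType} (g : 'I_4 -> R) i : min4 g <= g i.
Proof. exact: bigmin_le_cond. Qed.

Lemma min4P {R : realType} (g : 'I_4 -> R) : exists i, min4 g = g i.
Proof.
rewrite /min4; elim/big_ind : _ => [|x y [i ->] [j ->]|i _]; first by exists ord0.
  by rewrite minEle; case: ifP => _; [exists i|exists j].
by exists i.
Qed.

Lemma measurable_min4 d (T : measurableType d) (R : realType) (g : T -> 'I_4 -> R) :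
  (forall i, measurable_fun setT (fun t => g t i)) -> measurable_fun setT (fun t => min4 (g t)).
Proof.
move=> mg; rewrite /min4.
under eq_fun do rewrite big_ord_recl big_ord_recl big_ord_recl big_ord_recl big_ord0.
by repeat apply: measurable_minr => //.
Qed.

Definition quad {T : Type} (a b c e : T) (i : 'I_4) : T := nth a [:: a; b; c; e] i.

(** * The environment, its weights and its shifts *)

Notation site := (int + edge)%type.

Definition edge_var (R : realType) (f : cyl site R) : edge -> R := fun e => f (inr e).

Definition weight_eta {R : realType} (mu mu0 : probability R R) (f : cyl site R) : edge -> R :=
  tau_eta mu mu0 (fun x => f (inl x) == 1) (edge_var f).

Definition weight {R : realType} (mu : probability R R) (f : cyl site R) : edge -> R :=
  fun e => qf mu (f (inr e)).

(** Both quantiles are taken at the same uniform variable. This dominates [weight_eta] whatever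
    [eta] is and, not depending on [eta], commutes with shifts in both directions. *)
Definition weight_max {R : realType} (mu mu0 : probability R R) (f : cyl site R) : edge -> R :=
  fun e => Num.max (weight mu f e) (weight mu0 f e).

(** Column variables stay in place. For vertical shifts this is the true action on [weight_eta];
    weights that ignore [eta] may be shifted horizontally too. *)
Definition shift_site (v : vertex) (i : site) : site :=
  match i with inl x => inl x | inr e => inr (shift_edge v e) end.

Definition shift_env {R : realType} (v : vertex) (f : cyl site R) : cyl site R :=
  pull (shift_site v) f.

Lemma le_sum4 (a b c e : nat) : [/\ a <= a + b + c + e, b <= a + b + c + e,
  c <= a + b + c + e & e <= a + b + c + e]%N.
Proof. by split; lia. Qed.

Section measurability_of_times.
Context d (T : measurableType d) {R : realType} (W : T -> edge -> R).
Hypothesis mW : forall e, measurable_fun setT (fun f => W f e).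

Lemma measurable_path_time u p : measurable_fun setT (fun f => path_time (W f) u p).
Proof.
have -> : (fun f => path_time (W f) u p) = (fun f => \sum_(e <- path_edges u p) W f e).
  by apply/funext => f; rewrite path_timeE.
by apply: measurable_sum => e.
Qed.

Lemma measurable_min_time u s : measurable_fun setT (fun f => min_time (W f) u s).
Proof.
rewrite /min_time; elim: s (head _ _) => [|p s IH] t0.
  rewrite (_ : (fun _ => _) = (fun f => path_time (W f) u t0)); first exact: measurable_path_time.
  by apply/funext => f; rewrite big_nil.
rewrite (_ : (fun _ => _) = (fun f => Num.min (path_time (W f) u p)
    (\big[Num.min/path_time (W f) u t0]_(q <- s) path_time (W f) u q))).
  by apply: measurable_minr; [exact: measurable_path_time|exact: IH].
by apply/funext => f; rewrite big_cons.
Qed.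

Lemma measurable_passage_time u v : (forall f e, 0 <= W f e) ->
  measurable_fun setT (fun f => passage_time (W f) u v).
Proof.
move=> W0; apply: (measurable_fun_cvg (h := fun (N : nat) f => min_time (W f) u (routes u v N))).
  by move=> N; exact: measurable_min_time.
by move=> f _; exact: min_time_routes_cvg.
Qed.

End measurability_of_times.

Section weights.
Context {R : realType} (mu mu0 : probability R R).
Hypotheses (mu_nonneg : supported_nonneg mu) (mu0_nonneg : supported_nonneg mu0).

Lemma measurable_weight e : measurable_fun setT (fun f => weight mu f e).
Proof. exact: (measurableT_comp (measurable_qf mu_nonneg) (measurable_coord _)). Qed.

Lemma weight_ge0 f e : 0 <= weight mu f e.
Proof. exact: qf_nonneg. Qed.

End weights.

Section mixed_weights.
Context {R : realType} (mu mu0 : probability R R).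
Hypotheses (mu_nonneg : supported_nonneg mu) (mu0_nonneg : supported_nonneg mu0).

Lemma measurable_weight_max e : measurable_fun setT (fun f => weight_max mu mu0 f e).
Proof. by apply: measurable_maxr; exact: measurable_weight. Qed.

Lemma weight_max_ge0 f e : 0 <= weight_max mu mu0 f e.
Proof. by rewrite le_max weight_ge0. Qed.

Lemma weight_max_shift v f : weight_max mu mu0 (shift_env v f) = weight_max mu mu0 f \o shift_edge v.
Proof. by []. Qed.

Lemma measurable_eta x : measurable_fun setT (fun f : cyl site R => f (inl x) == 1).
Proof. by apply: measurable_fun_eqr => //; exact: measurable_coord. Qed.

Lemma measurable_weight_eta e : measurable_fun setT (fun f => weight_eta mu mu0 f e).
Proof.
rewrite /weight_eta /tau_eta; case: e.2.
  apply: measurable_fun_ifT; [exact: measurable_eta|exact: measurable_weight..].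
apply: measurable_fun_ifT; [|exact: measurable_weight..].
by apply: measurable_and; exact: measurable_eta.
Qed.

Lemma weight_eta_cases f e : weight_eta mu mu0 f e = weight mu f e \/
  weight_eta mu mu0 f e = weight mu0 f e.
Proof. by rewrite /weight_eta /tau_eta; do 2?case: ifP => _; [right|left|right|left]. Qed.

Lemma weight_eta_ge0 f e : 0 <= weight_eta mu mu0 f e.
Proof. by case: (weight_eta_cases f e) => ->; exact: weight_ge0. Qed.

Lemma weight_eta_le f e : weight_eta mu mu0 f e <= weight_max mu mu0 f e.
Proof. by case: (weight_eta_cases f e) => ->; rewrite le_max lexx ?orbT. Qed.

Lemma weight_eta_shift (k : int) f :
  weight_eta mu mu0 (shift_env (0, k) f) = weight_eta mu mu0 f \o shift_edge (0, k).
Proof.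
apply/funext => -[[x y] b]; rewrite /weight_eta /tau_eta /=; case: b => /=; by rewrite addr0.
Qed.

End mixed_weights.

Section environment.
Context {R : realType} (Q : probability (cyl site R) R).
Hypothesis indepQ : forall (J : seq site) (B : site -> set R), uniq J ->
  (forall i, measurable (B i)) ->
  Q (box J B) = (\prod_(i <- J) Q [set f | B i (f i)])%E.
Hypothesis uniformQ : forall e (t : R), 0 <= t <= 1 ->
  Q [set f : cyl site R | f (inr e) <= t] = t%:E.

(** The uniform law is given for thresholds in [[0, 1]]; monotonicity settles the other rays, and
    rays determine the law. *)
Lemma edge_law e e' (B : set R) : measurable B ->
  Q [set f | B (f (inr e))] = Q [set f | B (f (inr e'))].
Proof.
move=> mB.
have law k : exists m : {measure set R -> \bar R}, forall A,
    m A = Q ((fun f : cyl site R => f (inr k)) @^-1` A).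
  exact: (exists_image_measure Q (measurable_coord (inr k))).
have [m mE] := law e; have [m' mE'] := law e'.
transitivity (m B); first by rewrite mE.
transitivity (m' B); last by rewrite mE'.
have ray0 (h : {measure set R -> \bar R}) k :
    (forall A, h A = Q ((fun f : cyl site R => f (inr k)) @^-1` A)) ->
    forall x, h [set y : R | y <= x] = (Num.min 1 (Num.max 0 x))%:E.
  move=> hE x; rewrite hE.
  have mle t : measurable [set f : cyl site R | f (inr k) <= t].
    by apply: measurable_set_le => //; exact: measurable_coord.
  have [x0|x0] := leP x 0.
    rewrite (min_idPr _) ?ler01 //; apply/eqP; rewrite eq_le measure_ge0 andbT.
    have q0 : Q [set f : cyl site R | f (inr k) <= 0] = 0%E by apply: etrans (uniformQ _ _) _; rewrite ?lexx ?ler01.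
    by rewrite -[leRHS]q0; apply: le_measure; rewrite ?inE; [exact: mle|exact: mle|move=> f /= /le_trans; apply].
  have [x1|x1] := leP x 1.
    by apply: etrans (uniformQ _ _) _ => //; rewrite x1 ltW.
  apply/eqP; rewrite eq_le probability_le1 /=; last exact: mle.
  have q1 : Q [set f : cyl site R | f (inr k) <= 1] = 1%E by apply: etrans (uniformQ _ _) _; rewrite ?lexx ?ler01.
  by rewrite -[leLHS]q1; apply: le_measure; rewrite ?inE; [exact: mle|exact: mle|move=> f /= /le_trans; apply; exact: ltW].
apply: (probability_real_unique (m1 := m) (m2 := m')) => [||x|] //.
- by rewrite mE preimage_setT; exact: probability_setT.
- by rewrite mE' preimage_setT; exact: probability_setT.
- by rewrite (ray0 _ _ mE) (ray0 _ _ mE').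
Qed.

Lemma measurable_shift_env v : measurable_fun setT (@shift_env R v).
Proof. exact: measurable_pull. Qed.

Lemma shift_env_preserves v A : measurable A -> Q (shift_env v @^-1` A) = Q A.
Proof.
move=> mA; have := @reindex_law _ _ Q indepQ _ (shift_site v) id _ _ _ A mA.
apply => //.
- move=> [x|e] [y|e'] //= h.
  by congr inr; exact: (shift_edge_inj (congr1 (fun s : site => if s is inr k then k else e) h)).
- by case=> [x|e] B mB //; exact: edge_law.
Qed.

(** Carries the moment assumption from the four edges at the origin to any four distinct edges. *)
Lemma edge_reindex_integral (I' : eqType) (s t : I' -> edge) (H : cyl I' R -> \bar R) :
  injective s -> injective t -> measurable_fun setT H -> (forall x, 0 <= H x)%E ->
  (\int[Q]_f H (pull (inr \o s) f) = \int[Q]_f H (pull (inr \o t) f))%E.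
Proof.
move=> injs injt mH H0.
have [m mE] := exists_image_measure Q (@measurable_pull _ _ R (inr \o t : I' -> site)).
rewrite (ge0_integral_comp (m' := m) (@measurable_pull _ _ R (inr \o s : I' -> site))) //.
  by rewrite (ge0_integral_comp (m' := m) (@measurable_pull _ _ R (inr \o t : I' -> site))).
move=> A mA; rewrite mE; apply: (reindex_law indepQ) => //.
- by move=> i j [] /injs.
- by move=> i j [] /injt.
- by move=> i B mB; exact: edge_law.
Qed.

Section integrability.
Variables mu mu0 : probability R R.
Hypotheses (mu_nonneg : supported_nonneg mu) (mu0_nonneg : supported_nonneg mu0).
Hypothesis Y_fin : (\int[Q]_f (Y_of mu (fun e f => edge_var f e) f)%:E < +oo)%E.
Hypothesis Y0_fin : (\int[Q]_f (Y_of mu0 (fun e f => edge_var f e) f)%:E < +oo)%E.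

Let m4 (nu : probability R R) (g : cyl 'I_4 R) : R := min4 (fun i => qf nu (g i)).

Let mm4 nu : supported_nonneg nu -> measurable_fun setT (m4 nu).
Proof.
move=> nn; apply: measurable_min4 => i.
exact: (measurableT_comp (measurable_qf nn) (measurable_coord _)).
Qed.

Let m4_ge0 nu g : supported_nonneg nu -> 0 <= m4 nu g.
Proof. by move=> nn; rewrite /m4; have [i ->] := min4P (fun i => qf nu (g i)); exact: qf_nonneg. Qed.

Let o4 := quad (origin, false) ((-1, 0), false) (origin, true) ((0, -1), true) : 'I_4 -> edge.

Let quad_inj (T : eqType) (a b c e : T) : uniq [:: a; b; c; e] -> injective (quad a b c e).
Proof.
move=> u i j ij; apply/val_inj/eqP; by rewrite -(nth_uniq a _ _ u); [exact/eqP|exact: ltn_ord|exact: ltn_ord].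
Qed.

Let Y_of_m4 nu f : Y_of nu (fun e (f : cyl site R) => edge_var f e) f = m4 nu (pull (inr \o o4) f).
Proof.
rewrite /Y_of /m4 /min4 /origin_edges.
rewrite !big_cons big_nil big_ord_recl big_ord_recl big_ord_recl big_ord_recl big_ord0.
by [].
Qed.

Let m4_fin nu s : supported_nonneg nu -> injective s ->
  (\int[Q]_f (Y_of nu (fun e f => edge_var f e) f)%:E < +oo)%E ->
  (\int[Q]_f (m4 nu (pull (inr \o s) f))%:E < +oo)%E.
Proof.
move=> nn injs fin.
rewrite (@edge_reindex_integral _ s o4 (fun g => (m4 nu g)%:E)) //.
- by under eq_integral do rewrite -Y_of_m4.
- exact: quad_inj.
- by apply/measurable_EFinP; exact: mm4.
- by move=> x; rewrite lee_fin m4_ge0.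
Qed.

(* The same uniform variable drives both quantile functions, so the minimum of the
   four maxima is attained at the smallest of the four uniforms. *)
Let min4_weight_max (s : 'I_4 -> edge) f : (forall i, 0 < f (inr (s i)) < 1) ->
  min4 (fun i => weight_max mu mu0 f (s i)) <=
  m4 mu (pull (inr \o s) f) + m4 mu0 (pull (inr \o s) f).
Proof.
move=> f01; have [j jmin] : exists j, forall i, f (inr (s j)) <= f (inr (s i)).
  have [j jE] := min4P (fun i => f (inr (s i))); exists j => i.
  by rewrite -jE; exact: min4_le.
have le_m4 nu : supported_nonneg nu -> qf nu (f (inr (s j))) <= m4 nu (pull (inr \o s) f).
  move=> nn; rewrite /m4; have [i ->] := min4P (fun i => qf nu (pull (inr \o s) f i)).
  by apply: qf_homo; [|case/andP: (f01 j)|exact: jmin|case/andP: (f01 i)].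
apply: le_trans (min4_le _ j) _.
rewrite /weight_max /weight ge_max; apply/andP; split.
  by rewrite -[leLHS]addr0; apply: lerD; [exact: le_m4|exact: m4_ge0].
by rewrite -[leLHS]add0r; apply: lerD; [exact: m4_ge0|exact: le_m4].
Qed.

Lemma edge_var_ae (s : seq edge) : {ae Q, forall f, forall e, e \in s -> 0 < f (inr e) < 1}.
Proof.
elim: s => [|e s IH]; first exact: aeW.
have U := uniform_ae (measurable_coord (inr e)) (uniformQ e).
apply: ae_imp2 IH U => f h1 h2 e'.
by rewrite inE => /orP[/eqP->|/h1].
Qed.

Let min4_fin a b c e : uniq [:: a; b; c; e] ->
  (\int[Q]_f (min4 (fun i => weight_max mu mu0 f (quad a b c e i)))%:E < +oo)%E.
Proof.
move=> u; have injs := quad_inj u.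
have mm nu : supported_nonneg nu ->
    measurable_fun setT (fun f : cyl site R => m4 nu (pull (inr \o quad a b c e) f)).
  by move=> nn; exact: (measurableT_comp (mm4 nn) (@measurable_pull _ _ R (inr \o quad a b c e : 'I_4 -> site))).
apply: (@le_lt_trans _ _ (\int[Q]_f ((m4 mu (pull (inr \o quad a b c e) f))%:E +
    (m4 mu0 (pull (inr \o quad a b c e) f))%:E))%E).
  apply: ae_ge0_le_integral => //.
  - move=> f _; rewrite lee_fin.
    have [i ->] := min4P (fun i => weight_max mu mu0 f (quad a b c e i)).
    exact: weight_max_ge0.
  - apply/measurable_EFinP; apply: measurable_min4 => i; exact: measurable_weight_max.
  - by move=> f _; rewrite -EFinD lee_fin addr_ge0 // m4_ge0.
  - by apply: emeasurable_funD; apply/measurable_EFinP; exact: mm.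
  - apply: ae_imp (edge_var_ae [:: a; b; c; e]) => f hf _.
    rewrite -EFinD lee_fin; apply: min4_weight_max => i; apply: hf.
    exact: mem_nth.
rewrite ge0_integralD //; first by rewrite lte_add_pinfty // m4_fin.
- by move=> f _; rewrite lee_fin m4_ge0.
- by apply/measurable_EFinP; exact: mm.
- by move=> f _; rewrite lee_fin m4_ge0.
- by apply/measurable_EFinP; exact: mm.
Qed.

Let integrable_bigsum (T : eqType) (E : seq T) (F : T -> cyl site R -> R) :
  (forall x, x \in E -> Q.-integrable setT (EFin \o F x)) ->
  Q.-integrable setT (EFin \o (fun f => \sum_(x <- E) F x f)).
Proof.
elim: E => [|x E IH] h.
  by under [X in _ \o X]eq_fun do rewrite big_nil; exact: integrable0.
under [X in _ \o X]eq_fun do rewrite big_cons.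
by apply: (integrableD measurableT (h x _) (IH _)); rewrite ?mem_head // => y yE; apply: h; rewrite inE yE orbT.
Qed.

(** On each of four disjoint paths the heaviest edge bounds the time up to a factor. Hence the
    cheapest path costs at most a constant times the minimum of four distinct weights, which is
    integrable. *)
Lemma adj_route_integrable u v : adj u v ->
  exists2 s, route u v s & Q.-integrable setT (fun f => (min_time (weight_max mu mu0 f) u s)%:E).
Proof.
move=> uv; have [s [s4 sp su]] := four_disjoint_paths uv.
exists s; first by rewrite /route sp; case: (s) s4.
case: s s4 sp su => [|p1 [|p2 [|p3 [|p4 [|//]]]]] //= _.
move=> /and5P[vp1 vp2 vp3 vp4 _].
have uv' : u != v.
  by apply: contraTneq uv => ->; rewrite /adj !subrr.
have edges0 p : is_path u v p -> path_edges u p != [::].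
  by case: p => //; rewrite /is_path /= => /eqP e; move: uv'; rewrite e eqxx.
rewrite cats0; set E1 := path_edges u p1; set E2 := path_edges u p2.
set E3 := path_edges u p3; set E4 := path_edges u p4 => su.
pose K : R := (size E1 + size E2 + size E3 + size E4)%:R.
pose m a b c e f := min4 (fun i => weight_max mu mu0 f (quad a b c e i)).
have m_ge0 a b c e f : 0 <= m a b c e f.
  rewrite /m; have [i ->] := min4P (fun i => weight_max mu mu0 f (quad a b c e i)).
  exact: weight_max_ge0.
(* Which edges are heaviest depends on [f]; summing over all choices of one edge per path leaves
   finitely many integrable terms. *)
pose S f := \sum_(a <- E1) \sum_(b <- E2) \sum_(c <- E3) \sum_(e <- E4) K * m a b c e f.
have iS : Q.-integrable setT (EFin \o S).
  apply: integrable_bigsum => a aE; apply: integrable_bigsum => b bE.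
  apply: integrable_bigsum => c cE; apply: integrable_bigsum => e eE.
  apply: (eq_integrable measurableT (fun f => K%:E * (EFin \o m a b c e) f)%E).
    by move=> f _; rewrite /= EFinM.
  apply: integrableZl => //; apply: ge0_integrable.
  - by apply: measurable_min4 => i; exact: measurable_weight_max.
  - by move=> f; exact: m_ge0.
  - apply: min4_fin; move: su; rewrite !cat_uniq.
    move=> /and3P[_ /hasPn h1 /and3P[_ /hasPn h2 /and3P[_ /hasPn h3 _]]].
    rewrite /= !inE !negb_or andbT.
    apply/and3P; split; [apply/and3P; split| apply/andP; split |].
    + by apply: contraTneq aE => ->; apply: (h1 b); rewrite mem_cat bE.
    + by apply: contraTneq aE => ->; apply: (h1 c); rewrite !mem_cat cE orbT.
    + by apply: contraTneq aE => ->; apply: (h1 e); rewrite !mem_cat eE !orbT.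
    + by apply: contraTneq bE => ->; apply: (h2 c); rewrite !mem_cat cE.
    + by apply: contraTneq bE => ->; apply: (h2 e); rewrite !mem_cat eE !orbT.
    + by apply: contraTneq cE => ->; exact: (h3 e).
apply: (le_integrable measurableT _ _ iS).
  by apply/measurable_EFinP; apply: measurable_min_time => e; exact: measurable_weight_max.
have W0 f e : 0 <= weight_max mu mu0 f e by exact: weight_max_ge0.
move=> f _; rewrite /= lee_fin ger0_norm ?min_time_ge0 // ger0_norm; last first.
  by do 4!(apply: sumr_ge0 => ? _); rewrite mulr_ge0.
have [a aE le1] := sum_le_max_term (weight_max mu mu0 f) (edges0 _ vp1).
have [b bE le2] := sum_le_max_term (weight_max mu mu0 f) (edges0 _ vp2).
have [c cE le3] := sum_le_max_term (weight_max mu mu0 f) (edges0 _ vp3).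
have [e eE le4] := sum_le_max_term (weight_max mu mu0 f) (edges0 _ vp4).
apply: (@le_trans _ _ (K * m a b c e f)); last first.
  apply: le_trans (term_le_sum (F := fun e => K * m a b c e f) _ eE) _.
    by move=> x; rewrite mulr_ge0.
  apply: le_trans (term_le_sum (F := fun c => \sum_(e <- E4) K * m a b c e f) _ cE) _.
    by move=> x; do 1!(apply: sumr_ge0 => ? _); rewrite mulr_ge0.
  apply: le_trans (term_le_sum (F := fun b => \sum_(c <- E3) \sum_(e <- E4) K * m a b c e f) _ bE) _.
    by move=> x; do 2!(apply: sumr_ge0 => ? _); rewrite mulr_ge0.
  apply: le_trans (term_le_sum (F := fun a => \sum_(b <- E2) \sum_(c <- E3) \sum_(e <- E4) K * m a b c e f) _ aE) _ => //.
  by move=> x; do 3!(apply: sumr_ge0 => ? _); rewrite mulr_ge0.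
have [k1 k2 k3 k4] := le_sum4 (size E1) (size E2) (size E3) (size E4).
have bound p (x : edge) (n : nat) : p \in [:: p1; p2; p3; p4] -> (n <= size E1 + size E2 + size E3 + size E4)%N ->
    \sum_(y <- path_edges u p) weight_max mu mu0 f y <= n%:R * weight_max mu mu0 f x ->
    min_time (weight_max mu mu0 f) u [:: p1; p2; p3; p4] <= K * weight_max mu mu0 f x.
  move=> ps nK le; apply: le_trans (min_time_le _ _ ps) _; rewrite path_timeE.
  by apply: le_trans le _; rewrite ler_wpM2r // ler_nat.
(* The index at which the minimum of the four weights is attained names the path to take. *)
rewrite /m; have [i ->] := min4P (fun i => weight_max mu mu0 f (quad a b c e i)).
case: i => -[|[|[|[|//]]]] ilt; rewrite /quad /=.
- by apply: (bound p1 _ _ _ _ le1); rewrite ?inE ?eqxx ?orbT.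
- by apply: (bound p2 _ _ _ _ le2); rewrite ?inE ?eqxx ?orbT.
- by apply: (bound p3 _ _ _ _ le3); rewrite ?inE ?eqxx ?orbT.
- by apply: (bound p4 _ _ _ _ le4); rewrite ?inE ?eqxx ?orbT.
Qed.

(** The minimum over all concatenations is at most the sum of the two minima, so integrability
    passes from neighbours to all pairs. *)
Lemma route_integrable u v :
  exists2 s, route u v s & Q.-integrable setT (fun f => (min_time (weight_max mu mu0 f) u s)%:E).
Proof.
have W0 f e : 0 <= weight_max mu mu0 f e by exact: weight_max_ge0.
apply: (lattice_ind (S := fun u v => exists2 s, route u v s &
  Q.-integrable setT (fun f => (min_time (weight_max mu mu0 f) u s)%:E))) => {u v} [u|u v z|u v].
- exists [:: [::]]; first by rewrite /route /is_path /= eqxx.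
  apply: (eq_integrable measurableT (cst 0%E)); last exact: integrable0.
  by move=> f _; rewrite /min_time big_cons big_nil /= !path_timeE /path_edges /= !big_nil minxx.
- move=> [s sr si] [t tr ti].
  have [s0 /allP sp] := andP sr; have [t0 /allP tp] := andP tr.
  exists [seq p ++ q | p <- s, q <- t].
    apply/andP; split; last first.
      apply/allP => _ /allpairsP[[p q] /= [ps qt ->]].
      exact: is_path_cat (sp p ps) (tp q qt).
    by case: (s) s0 => // a s' _; case: (t) t0.
  apply: (le_integrable measurableT _ _ (integrableD measurableT si ti)).
    by apply/measurable_EFinP; apply: measurable_min_time => e; exact: measurable_weight_max.
  move=> f _; rewrite /= lee_fin !ger0_norm ?addr_ge0 ?min_time_ge0 //.
  have [p ps ->] := min_timeP (weight_max mu mu0 f) u s0.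
  have [q qt ->] := min_timeP (weight_max mu mu0 f) v t0.
  have -> : v = last u p by case/andP: (sp p ps) => _ /eqP.
  by rewrite -path_time_cat; apply: min_time_le; apply/allpairsP; exists (p, q).
- exact: adj_route_integrable.
Qed.

End integrability.
End environment.

(** * Comparison under the concave order *)

(** Bounds are asked only on the half-line carrying [nu]: as a function of one weight a capped time
    is concave on the whole line and may tend to minus infinity at negative arguments. *)
Lemma bounded_nonneg_integrable {R : realType} (nu : probability R R) (phi : R -> R) (C : R) :
  supported_nonneg nu -> measurable_fun setT phi ->
  (forall x, 0 <= x -> 0 <= phi x <= C) -> nu.-integrable setT (EFin \o phi).
Proof.
move=> nn mphi phiC.
have mnn : measurable [set y : R | 0 <= y] by have := @measurable_itv R `[0, +oo[; rewrite set_itvE.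
apply/(@negligible_integrable _ _ _ nu setT (~` [set y : R | 0 <= y])) => //.
- exact: measurableC.
- exact/measurable_EFinP.
- by apply: etrans (probability_setC _ mnn) _; rewrite nn subee.
apply: measurable_bounded_integrable.
- by apply: measurableD => //; exact: measurableC.
- by rewrite (le_lt_trans (probability_le1 _ _)) ?ltry //; apply: measurableD => //; exact: measurableC.
- exact: measurable_funTS.
- exists C; split; first exact: num_real.
  move=> M CM x [_ /contrapT /= x0]; have /andP[p0 pC] := phiC x x0.
  by rewrite ger0_norm // (le_trans pC) // ltW.
Qed.

Definition set_edge {R : realType} (w : edge -> R) (e : edge) (x : R) : edge -> R :=
  fun e' => if e' == e then x else w e'.

Lemma path_time_affine {R : realType} (w : edge -> R) e u p (x y t : R) :
  path_time (set_edge w e (t * x + (1 - t) * y)) u p =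
  t * path_time (set_edge w e x) u p + (1 - t) * path_time (set_edge w e y) u p.
Proof.
rewrite !path_timeE !mulr_sumr -big_split /=; apply: eq_bigr => e' _.
by rewrite /set_edge; case: eqP => // _; ring.
Qed.

(** The cap bounds the test function from above without destroying concavity, so both integrals in
    [concave_order] converge. *)
Definition capped_time {R : realType} (C : R) (w : edge -> R) u s : R := Num.min C (min_time w u s).

(** A path time is affine in each single weight, with slope the number of uses of the edge; the
    minimum of affine functions and a constant is concave. *)
Lemma capped_time_concave {R : realType} (C : R) (w : edge -> R) e u s : s != [::] ->
  concave_fun (fun x => capped_time C (set_edge w e x) u s).
Proof.
move=> s0 x y t /andP[t0 t1]; rewrite /capped_time.
have t1' : 0 <= 1 - t by rewrite subr_ge0.
rewrite le_min; apply/andP; split.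
  rewrite [leRHS](_ : C = t * C + (1 - t) * C); last by ring.
  by apply: lerD; apply: ler_wpM2l => //; rewrite ge_min lexx.
have [p ps ->] := min_timeP (set_edge w e (t * x + (1 - t) * y)) u s0.
rewrite path_time_affine.
by apply: lerD; apply: ler_wpM2l => //; rewrite ge_min min_time_le ?orbT.
Qed.

Lemma capped_time_homo {R : realType} (C : R) (w : edge -> R) e u s :
  {homo (fun x => capped_time C (set_edge w e x) u s) : x y / x <= y}.
Proof.
move=> x y xy /=; rewrite /capped_time le_min; apply/andP; split.
  by rewrite ge_min lexx.
rewrite ge_min; apply/orP; right.
by apply: le_min_time => e'; rewrite /set_edge; case: eqP.
Qed.

Lemma capped_time_bounds {R : realType} (C : R) (w : edge -> R) u s : 0 <= C ->
  (forall e, 0 <= w e) -> 0 <= capped_time C w u s <= C.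
Proof. by move=> C0 w0; rewrite /capped_time le_min C0 min_time_ge0 //= ge_min lexx. Qed.

Lemma cvg_min_cst {R : realType} (C l : R) (x : nat -> R) :
  x n @[n --> \oo] --> l -> Num.min C (x n) @[n --> \oo] --> Num.min C l.
Proof.
move=> /cvgrPdist_le xl; apply/cvgrPdist_le => e e0.
apply: filterS (xl e e0) => n; rewrite !ler_norml => /andP[h1 h2].
by rewrite !minEle; case: ifP; case: ifP; move=> ? ?; apply/andP; split; lra.
Qed.

Section comparison.
Context {R : realType} (Q : probability (cyl site R) R).
Hypothesis indepQ : forall (J : seq site) (B : site -> set R), uniq J ->
  (forall i, measurable (B i)) ->
  Q (box J B) = (\prod_(i <- J) Q [set f | B i (f i)])%E.
Hypothesis uniformQ : forall e (t : R), 0 <= t <= 1 ->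
  Q [set f : cyl site R | f (inr e) <= t] = t%:E.
Variables mu mu0 : probability R R.
Hypotheses (mu_nonneg : supported_nonneg mu) (mu0_nonneg : supported_nonneg mu0).
Hypothesis order_mu : concave_order mu0 mu.

(** Interpolates between the two environments: edges of [L] already carry the weights of T_eta, the
    others still those of F_0. *)
Let hyb (L : seq edge) (f : cyl site R) : edge -> R :=
  fun e => if e \in L then weight_eta mu mu0 f e else weight mu0 f e.

Let hyb_ge0 L f e : 0 <= hyb L f e.
Proof. by rewrite /hyb; case: ifP => _; [exact: weight_eta_ge0|exact: weight_ge0]. Qed.

Let measurable_hyb L e : measurable_fun setT (fun f => hyb L f e).
Proof. by rewrite /hyb; case: (e \in L); [exact: measurable_weight_eta|exact: measurable_weight]. Qed.

Let measurable_capped C L u s : measurable_fun setT (fun f => capped_time C (hyb L f) u s).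
Proof. by apply: measurable_minr => //; apply: measurable_min_time => e; exact: measurable_hyb. Qed.

Let uses_mu0 (f : cyl site R) (e : edge) : bool :=
  if e.2 then f (inl e.1.1) == 1 else (f (inl e.1.1) == 1) && (f (inl (e.1.1 + 1)) == 1).

Let weight_etaE f e : weight_eta mu mu0 f e = if uses_mu0 f e then weight mu0 f e else weight mu f e.
Proof. by rewrite /weight_eta /tau_eta /uses_mu0; case: e.2. Qed.

Let hyb_upd L f e t : e \notin L ->
  hyb L (upd f (inr e) t) = set_edge (hyb L f) e (qf mu0 t).
Proof.
move=> eL; apply/funext => e'; rewrite /set_edge /hyb.
have [->|ne] := eqVneq e' e; first by rewrite (negbTE eL) /weight /upd eqxx.
have ne' : (inr e' == inr e :> site) = false by exact/negbTE.
by rewrite !weight_etaE /weight /uses_mu0 /upd /= ne'.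
Qed.

Let hyb_cons_upd L f e t : e \notin L ->
  hyb (e :: L) (upd f (inr e) t) =
  set_edge (hyb L f) e (if uses_mu0 f e then qf mu0 t else qf mu t).
Proof.
move=> eL; apply/funext => e'; rewrite /set_edge /hyb inE.
have [->|ne] /= := eqVneq e' e.
  by rewrite weight_etaE /weight /uses_mu0 /upd /= eqxx.
have ne' : (inr e' == inr e :> site) = false by exact/negbTE.
by rewrite !weight_etaE /weight /uses_mu0 /upd /= ne'.
Qed.

(** Resample the uniform variable of [e]. The distribution used at [e] is decided by [eta] alone, so
    with all else frozen both sides integrate one and the same concave function, against the laws of
    the old and of the new weight. *)
Let capped_step C L e u s : 0 <= C -> s != [::] ->
  (\int[Q]_f (capped_time C (hyb L f) u s)%:E <=
   \int[Q]_f (capped_time C (hyb (e :: L) f) u s)%:E)%E.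
Proof.
move=> C0 s0; have [eL|eL] := boolP (e \in L).
  rewrite le_eqVlt; apply/orP; left; apply/eqP; apply: eq_integral => f _.
  congr (capped_time C _ u s)%:E; apply/funext => e'; rewrite /hyb inE.
  by case: eqVneq => //= ->; rewrite eL.
have cap0 L' f : (0 <= (capped_time C (hyb L' f) u s)%:E)%E.
  by rewrite lee_fin; case/andP: (capped_time_bounds u s C0 (hyb_ge0 L' f)).
have mcap L' : measurable_fun setT (fun f => (capped_time C (hyb L' f) u s)%:E).
  exact/measurable_EFinP.
rewrite (resample indepQ (inr e) (mcap L) (cap0 L)).
rewrite (resample indepQ (inr e) (mcap (e :: L)) (cap0 (e :: L))).
apply: ge0_le_integral => //.
- by move=> f _; apply: integral_ge0.
- exact: (measurable_resample Q (inr e) (mcap L) (cap0 L)).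
- exact: (measurable_resample Q (inr e) (mcap (e :: L)) (cap0 (e :: L))).
move=> f _.
under eq_integral do rewrite (hyb_upd _ _ eL).
under [leRHS]eq_integral do rewrite (hyb_cons_upd _ _ eL).
(* Where [eta] assigns F_0 to [e] the two sides coincide. *)
have [//|_] := boolP (uses_mu0 f e).
pose phi x := capped_time C (set_edge (hyb L f) e x) u s.
have mphi : measurable_fun setT phi.
  apply: measurable_minr => //; apply: measurable_min_time => e'.
  by rewrite /set_edge; case: (e' == e).
have iphi nu : supported_nonneg nu -> nu.-integrable setT (EFin \o phi).
  move=> nn; apply: (bounded_nonneg_integrable (C := C)) => // x x0.
  by apply: capped_time_bounds => // e'; rewrite /set_edge; case: eqP.
have law nu : supported_nonneg nu ->
    (\int[Q]_g (phi (qf nu (g (inr e))))%:E = \int[nu]_x (phi x)%:E)%E.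
  move=> nn; have mX : measurable_fun setT (fun g : cyl site R => qf nu (g (inr e))).
    exact: measurable_weight.
  apply: (integral_comp mX) => [A mA|]; last exact: iphi.
  exact: (qf_law nn (measurable_coord (inr e)) (uniformQ e)).
rewrite (law mu0 mu0_nonneg) (law mu mu_nonneg); apply: order_mu.
- exact: capped_time_concave.
- exact: capped_time_homo.
- exact: iphi.
- exact: iphi.
Qed.

Lemma capped_time_comparison C u s : 0 <= C -> s != [::] ->
  (\int[Q]_f (capped_time C (weight mu0 f) u s)%:E <=
   \int[Q]_f (capped_time C (weight_eta mu mu0 f) u s)%:E)%E.
Proof.
move=> C0 s0; pose L := flatten (map (path_edges u) s).
have -> : (\int[Q]_f (capped_time C (weight_eta mu mu0 f) u s)%:E =
    \int[Q]_f (capped_time C (hyb L f) u s)%:E)%E.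
  apply: eq_integral => f _; congr (_%:E); rewrite /capped_time; congr Num.min.
  by apply: eq_min_time => e eL; rewrite /hyb eL.
elim: L => [//|e L IH]; apply: le_trans IH _.
exact: capped_step.
Qed.

(** At a fixed cap the finite families exhaust all paths, dominated by the cap. Then the cap is
    dropped on the right by monotonicity and sent to infinity on the left, dominated by the
    integrable F_0 passage time. *)
Lemma passage_time_comparison u v :
  Q.-integrable setT (fun f => (passage_time (weight mu0 f) u v)%:E) ->
  (\int[Q]_f (passage_time (weight mu0 f) u v)%:E <=
   \int[Q]_f (passage_time (weight_eta mu mu0 f) u v)%:E)%E.
Proof.
move=> iT.
have w0 f e := weight_ge0 mu0_nonneg f e.
have weta0 f e : 0 <= weight_eta mu mu0 f e by exact: weight_eta_ge0.
have mw := measurable_weight mu0_nonneg.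
have mweta e : measurable_fun setT (fun f => weight_eta mu mu0 f e) by exact: measurable_weight_eta.
have mT := measurable_passage_time mw u v w0.
have mTeta := measurable_passage_time mweta u v weta0.
have T0 f : 0 <= passage_time (weight mu0 f) u v by exact: passage_time_ge0.
have Teta0 f : 0 <= passage_time (weight_eta mu mu0 f) u v by exact: passage_time_ge0.
have cap_cvg C (W : cyl site R -> edge -> R) : 0 <= C -> (forall f e, 0 <= W f e) ->
    (forall e, measurable_fun setT (fun f => W f e)) ->
    (\int[Q]_f (capped_time C (W f) u (routes u v N))%:E)%E @[N --> \oo] -->
    (\int[Q]_f (Num.min C (passage_time (W f) u v))%:E)%E.
  move=> C0 W0 mW; apply: (dominated_cvg_integral (g := cst C)).
  - by move=> N; apply: measurable_minr => //; exact: measurable_min_time.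
  - by apply: measurable_minr => //; exact: measurable_passage_time.
  - apply: aeW => f; apply: cvg_min_cst; exact: min_time_routes_cvg.
  - exact: finite_measure_integrable_cst.
  - move=> N f; have /andP[c0 cC] := capped_time_bounds u (routes u v N) C0 (W0 f).
    by rewrite ger0_norm.
have cap_le C : 0 <= C ->
    (\int[Q]_f (Num.min C (passage_time (weight mu0 f) u v))%:E <=
     \int[Q]_f (passage_time (weight_eta mu mu0 f) u v)%:E)%E.
  move=> C0.
  apply: (@le_trans _ _ (\int[Q]_f (Num.min C (passage_time (weight_eta mu mu0 f) u v))%:E)%E).
    have c1 := cap_cvg C _ C0 w0 mw; have c2 := cap_cvg C _ C0 weta0 mweta.
    rewrite -(cvg_lim _ c1) // -(cvg_lim _ c2) //; apply: lee_lim.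
    - by apply/cvg_ex; eexists; exact: c1.
    - by apply/cvg_ex; eexists; exact: c2.
    - by apply: nearW => N; apply: capped_time_comparison.
  apply: ge0_le_integral => //.
  - by move=> f _; rewrite lee_fin le_min C0 Teta0.
  - by apply/measurable_EFinP; exact: measurable_minr.
  - exact/measurable_EFinP.
  - by move=> f _; rewrite lee_fin ge_min lexx orbT.
have cT : (\int[Q]_f (Num.min k%:R (passage_time (weight mu0 f) u v))%:E)%E @[k --> \oo] -->
    (\int[Q]_f (passage_time (weight mu0 f) u v)%:E)%E.
  apply: (dominated_cvg_integral _ mT _ iT).
  - by move=> k; exact: measurable_minr.
  - apply: aeW => f; apply: cvg_near_cst.
    exists (Num.truncn (passage_time (weight mu0 f) u v)).+1 => // k /= hk.
    apply/min_idPr; apply: le_trans (ltW (truncnS_gt _)) _.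
    by rewrite ler_nat.
  - by move=> k f; rewrite ger0_norm ?ge_min ?lexx ?orbT // le_min T0 ler0n.
rewrite -(cvg_lim _ cT) //; apply: lime_le; first by apply/cvg_ex; eexists; exact: cT.
by apply: nearW => k; exact: cap_le.
Qed.

End comparison.

(** * Almost sure bounds in the random environment *)

Lemma shift_env_comp {R : realType} v w (f : cyl site R) :
  shift_env v (shift_env w f) = shift_env (shift_vertex w v) f.
Proof.
by apply/funext => -[x|e] //; rewrite /shift_env /pull /= shift_edge_comp.
Qed.

Lemma iter_shift_env {R : realType} (k : int) j (f : cyl site R) :
  iter j (shift_env (0, k)) f = shift_env (0, k *+ j) f.
Proof.
elim: j => [|j IH].
  by apply/funext => -[x|e] //=; rewrite /shift_env /pull /= shift_edge0.
rewrite iterS IH shift_env_comp; congr (shift_env _ f).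
by rewrite /shift_vertex /= addr0 mulrS.
Qed.

(** Only edge variables may enter: vertical shifts carry them away from any finite set but fix
    [eta], so a changed column variable would be seen by all translates. *)
Definition depends_on {R : realType} {S : Type} (J : seq edge) (G : cyl site R -> S) :=
  forall f g, (forall e, e \in J -> f (inr e) = g (inr e)) -> G f = G g.

Lemma le_bigmax_mem (T : eqType) (s : seq T) (F : T -> nat) x :
  x \in s -> (F x <= \max_(y <- s) F y)%N.
Proof. by move=> xs; exact: leq_bigmax_seq. Qed.

Lemma shift_leaves (J : seq edge) (L : seq site) (k : nat) : (0 < k)%N ->
  exists j0, forall j e, (j0 <= j)%N -> e \in J ->
    (inr (shift_edge (0, k%:Z *+ j) e) : site) \notin L.
Proof.
move=> k0.
pose hgt (i : site) := if i is inr e then `|e.1.2|%N else 0%N.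
exists (\max_(i <- L) hgt i + \max_(e <- J) `|e.1.2|%N).+1 => j e j0j eJ.
apply/negP => /(le_bigmax_mem hgt) /= hL.
have hJ := le_bigmax_mem (fun e : edge => `|e.1.2|%N) eJ.
rewrite /= in hJ; move: (\max_(_ <- L) _)%N (\max_(_ <- J) _)%N j0j hL hJ => a b j0j hL hJ.
have jk : (j <= k * j)%N by rewrite leq_pmull.
have kjE : k%:Z *+ j = (k * j)%N%:Z by rewrite -mulr_natr PoszM natz.
move: hL; rewrite kjE; move: (e.1.2) hJ => y; move: (k * j)%N jk => z; clear -j0j; lia.
Qed.

Lemma far_column (M L n x j : nat) :
  (M + L + n < x)%N -> (`|(x%:Z - L%:Z + j%:Z)%R| <= M)%N -> False.
Proof. by lia. Qed.

Lemma near_column (L x : nat) (y : int) : (`|(y - x%:Z)%R| <= L)%N ->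
  (`|(y - x%:Z + L%:Z)%R| < L.*2.+1)%N /\ x%:Z - L%:Z + `|(y - x%:Z + L%:Z)%R|%N%:Z = y.
Proof. by lia. Qed.

Section ergodic.
Context {R : realType} (Q : probability (cyl site R) R).
Hypothesis indepQ : forall (J : seq site) (B : site -> set R), uniq J ->
  (forall i, measurable (B i)) ->
  Q (box J B) = (\prod_(i <- J) Q [set f | B i (f i)])%E.
Hypothesis uniformQ : forall e (t : R), 0 <= t <= 1 ->
  Q [set f : cyl site R | f (inr e) <= t] = t%:E.

(** The sums of [G - b] have negative drift. Their boundedness from above is insensitive to finitely
    many coordinates, since only finitely many translates of [J] meet these; so it has probability 0
    or 1, as the maximal argument requires. *)
Lemma ergodic_bound (G : cyl site R -> R) (J : seq edge) (k : nat) (b : R) :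
  (0 < k)%N -> depends_on J G -> Q.-integrable setT (EFin \o G) ->
  (\int[Q]_f (G f)%:E < b%:E)%E ->
  {ae Q, forall f, exists C : nat, forall n,
    \sum_(j < n) G (shift_env (0, k%:Z *+ j) f) <= n%:R * b + C%:R}.
Proof.
move=> k0 GJ iG Gb.
pose th := @shift_env R (0, k%:Z).
have mth : measurable_fun setT th := @measurable_shift_env R (0, k%:Z).
have Qth A : measurable A -> Q (th @^-1` A) = Q A by exact: (shift_env_preserves indepQ uniformQ).
pose h f := G f - b.
have icst : Q.-integrable setT (EFin \o cst b) by exact: finite_measure_integrable_cst.
have ih : Q.-integrable setT (EFin \o h).
  apply: (eq_integrable measurableT ((EFin \o G) \- (EFin \o cst b))%E) => //.
  exact: integrableB.
have h_lt0 : (\int[Q]_f (h f)%:E < 0)%E.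
  rewrite (_ : (\int[Q]_f (h f)%:E)%E = (\int[Q]_f (G f)%:E - b%:E)%E).
    by rewrite sube_lt0 //= orbT.
  rewrite (eq_integral (fun f => (EFin \o G) f - (EFin \o cst b) f)%E) //.
  rewrite (integralB measurableT iG icst).
  by rewrite /comp /= integral_cst //= [Q setT](@probability_setT _ _ _ Q) mule1.
have sumE n f : birkhoff_sum th h n f = \sum_(j < n) G (shift_env (0, k%:Z *+ j) f) - n%:R * b.
  rewrite /birkhoff_sum /h sumrB sumr_const card_ord mulr_natl; congr (_ - _).
  by apply: eq_bigr => j _; rewrite /th iter_shift_env.
have := bounded_sums_ae mth Qth ih h_lt0; move=> /(_ _)H.
apply: ae_imp (H _) => [f [C hC]|].
  by exists C => n; rewrite -lerBlDl -sumE; exact: hC.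
apply: (zero_one_law indepQ); first exact: (measurable_bounded_sums mth ih).
move=> L f g fg [C hC].
have [j0 hj0] := shift_leaves J L k0.
have Gfg j : (j0 <= j)%N -> G (shift_env (0, k%:Z *+ j) g) = G (shift_env (0, k%:Z *+ j) f).
  by move=> jj; apply: GJ => e eJ; rewrite /shift_env /pull /= fg // hj0.
(* The discrepancy between [f] and [g] stems from the first [j0] translates and goes into the
   constant. *)
pose d (j : nat) := `|G (shift_env (0, k%:Z *+ j) g) - G (shift_env (0, k%:Z *+ j) f)|.
exists (C + (Num.truncn (\sum_(j < j0) d j)).+1)%N => n.
have key : \sum_(j < n) G (shift_env (0, k%:Z *+ j) g) <=
    \sum_(j < n) G (shift_env (0, k%:Z *+ j) f) + \sum_(j < j0) d j.
  have -> : \sum_(j < j0) d j = \sum_(j < maxn j0 n) d j.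
    rewrite -(subnKC (leq_maxl j0 n)) big_split_ord /= [X in _ + X]big1 ?addr0 // => j _.
    by rewrite /d Gfg ?leq_addr // subrr normr0.
  have -> : \sum_(j < maxn j0 n) d j = \sum_(j < n) d j + \sum_(j < maxn j0 n - n) d (n + j)%N.
    by rewrite -[in LHS](subnKC (leq_maxr j0 n)) big_split_ord.
  rewrite addrA -[leLHS]addr0; apply: lerD; last by apply: sumr_ge0 => j _; exact: normr_ge0.
  rewrite -big_split /=; apply: ler_sum => j _.
  by rewrite -lerBlDl ler_norm.
rewrite sumE lerBlDr; apply: le_trans key _.
rewrite natrD -addrA [_ + n%:R * b]addrC addrA; apply: lerD; last exact/ltW/truncnS_gt.
by have := hC n; rewrite sumE lerBlDr.
Qed.

(** Truncation: the part of [G] above a large [M] has mean below [e], and a single translate of it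
    is at most the whole sum, which [ergodic_bound] controls. *)
Lemma linear_bound (G : cyl site R -> R) (J : seq edge) (k : nat) (e : R) :
  (0 < k)%N -> depends_on J G -> (forall f, 0 <= G f) ->
  Q.-integrable setT (EFin \o G) -> 0 < e ->
  {ae Q, forall f, exists C : nat, forall j, G (shift_env (0, k%:Z *+ j) f) <= j%:R * e + C%:R}.
Proof.
move=> k0 GJ G0 iG e0.
have mG : measurable_fun setT G by apply/measurable_EFinP; case/integrableP: iG.
pose big (M : nat) f := if M%:R < G f then G f else 0.
have mbig M : measurable_fun setT (big M).
  by apply: measurable_fun_ifT => //; apply: measurable_fun_ltr.
have big_bounds M f : 0 <= big M f <= G f by rewrite /big; case: ifP; rewrite ?lexx ?G0.
have ibig M : Q.-integrable setT (EFin \o big M).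
  apply: (le_integrable measurableT _ _ iG); first exact/measurable_EFinP.
  move=> f _; have /andP[b0 bG] := big_bounds M f.
  by rewrite /= lee_fin !ger0_norm.
have cv : (\int[Q]_f (big M f)%:E)%E @[M --> \oo] --> (\int[Q]_f (cst 0 f)%:E)%E.
  apply: (dominated_cvg_integral (f := cst 0) _ _ _ iG) => //.
    apply: aeW => f; apply: cvg_near_cst; exists (Num.truncn (G f)).+1 => // M /= hM.
    rewrite /big ltNge (_ : G f <= M%:R) //.
    by apply: le_trans (ltW (truncnS_gt _)) _; rewrite ler_nat.
  by move=> M f; have /andP[b0 bG] := big_bounds M f; rewrite ger0_norm.
have [M ltM] : exists M, (\int[Q]_f (big M f)%:E < e%:E)%E.
  move: cv; rewrite integral0 => /fine_cvgP[_ /cvgrPdist_lt/(_ e e0)[M _ /(_ M (leqnn _)) /=]].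
  rewrite sub0r normrN => lt; exists M.
  have fin : (\int[Q]_f (big M f)%:E)%E \is a fin_num by exact: integrable_fin_num (ibig M).
  by rewrite -(fineK fin) lte_fin (le_lt_trans (ler_norm _)).
have dbig : depends_on J (big M) by move=> f g /GJ fg; rewrite /big fg.
apply: ae_imp (ergodic_bound k0 dbig (ibig M) ltM) => f [C hC].
(* [M] covers the truncated part, [C] comes from the sums, and the last term exceeds [e] because the
   sum up to index [j] has [j + 1] terms. *)
exists (M + C + (Num.truncn e).+1)%N => j.
apply: (@le_trans _ _ (M%:R + big M (shift_env (0, k%:Z *+ j) f))).
  rewrite /big; case: ltP => [_|]; first by rewrite lerDr.
  by rewrite addr0.
have le1 : big M (shift_env (0, k%:Z *+ j) f) <= j.+1%:R * e + C%:R.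
  apply: le_trans (hC j.+1); rewrite big_ord_recr /= lerDr.
  by apply: sumr_ge0 => i _; case/andP: (big_bounds M (shift_env (0, k%:Z *+ i) f)).
have le2 := truncnS_gt e.
rewrite !natrD; move: le1; rewrite -natr1 mulrDl mul1r; lra.
Qed.

(** Every block of [2 L + 1] columns is full of ones with the same positive probability [c]. By
    continuity from above the limsup of these events has probability at least [c], and the zero-one
    law raises it to 1. *)
Lemma ones_run (eps : R) (L : nat) : 0 < eps ->
  (forall x, Q [set f : cyl site R | f (inl x) = 1] = eps%:E) ->
  {ae Q, forall f, exists x : int, forall y : int, (`|y - x|%N <= L)%N -> f (inl y) = 1}.
Proof.
move=> eps0 etaQ.
pose J (x : nat) : seq site := [seq inl (x%:Z - L%:Z + i%:Z) | i <- iota 0 L.*2.+1].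
pose A (x : nat) := box (J x) (fun=> [set (1 : R)]).
have uJ x : uniq (J x).
  rewrite map_inj_uniq ?iota_uniq // => i j ij.
  have := congr1 (fun s : site => if s is inl y then y else 0) ij; clear; lia.
have mA x : measurable (A x) by exact: measurable_box.
pose c := \prod_(i <- iota 0 L.*2.+1) eps.
have c0 : 0 < c by apply: prodr_gt0.
have QA x : Q (A x) = c%:E.
  rewrite indepQ // /J big_map /c -prodEFin.
  by apply: eq_bigr => i _; exact: etaQ.
have cvA : Q (\bigcup_(k >= n) A k) @[n --> \oo] --> Q (lim_sup_set A).
  apply: lim_sup_set_cvg => //.
  by rewrite (le_lt_trans (probability_le1 _ _)) ?ltry //; exact: bigcup_measurable.
have mls : measurable (lim_sup_set A).
  by apply: bigcapT_measurable => n; exact: bigcup_measurable.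
have Qge : (c%:E <= Q (lim_sup_set A))%E.
  rewrite -(cvg_lim _ cvA) //; apply: lime_ge; first by apply/cvg_ex; eexists; exact: cvA.
  apply: nearW => n; rewrite -(QA n); apply: le_measure; rewrite ?inE //.
    exact: bigcup_measurable.
  by move=> f Af; exists n => //=.
have [Q0|Q1] : Q (lim_sup_set A) = 0%E \/ Q (lim_sup_set A) = 1%E.
  apply: (zero_one_law indepQ) => // K f g fg lf n _.
  pose col (i : site) := if i is inl x then `|x|%N else 0%N.
  (* A block centred at or beyond [N] misses every column of [K], and its index is at least [n]. *)
  pose N := (\max_(i <- K) col i + L + n).+1%N.
  have [x /= Nx Ax] := lf N I.
  exists x => /=; first by rewrite (leq_trans _ Nx) // /N; lia.
  move=> i iJ; rewrite -fg; first exact: Ax.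
  apply/negP => iK; have := le_bigmax_mem col iK.
  by move: iJ => /mapP[j _ ->] /=; exact: far_column Nx.
- by move: Qge; rewrite Q0 lee_fin leNgt c0.
exists (~` lim_sup_set A); split; first exact: measurableC.
  by apply: etrans (probability_setC _ mls) _; rewrite Q1 subee.
move=> f /=; apply: contra_notP => /contrapT /(_ 0%N I) [x _ Ax].
exists x%:Z => y yx; have := Ax (inl y); apply; apply/mapP.
have [h1 h2] := near_column yx.
by exists `|(y - x%:Z + L%:Z)%R|%N; rewrite ?mem_iota ?h2.
Qed.

End ergodic.

Lemma min_time_depends_on {R : realType} (v : vertex) (W : cyl site R -> edge -> R) u s :
  (forall f g e, f (inr e) = g (inr e) -> W f e = W g e) ->
  (forall f, W (shift_env v f) = W f \o shift_edge v) ->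
  depends_on (map (shift_edge v) (flatten (map (path_edges u) s)))
    (fun f => min_time (W (shift_env v f)) u s).
Proof.
move=> Wloc Wshift f g fg; apply: eq_min_time => e eJ.
by rewrite !Wshift /=; apply: Wloc; apply: fg; exact: map_f.
Qed.

Lemma column_bound (M : nat) (x y : int) : (`|y|%N <= M)%N ->
  (`|(y + x - x)%R| <= M.+1)%N /\ (`|(y + x + 1 - x)%R| <= M.+1)%N.
Proof. by lia. Qed.

Section upper_bound.
Context {R : realType} (Q : probability (cyl site R) R).
Hypothesis indepQ : forall (J : seq site) (B : site -> set R), uniq J ->
  (forall i, measurable (B i)) ->
  Q (box J B) = (\prod_(i <- J) Q [set f | B i (f i)])%E.
Hypothesis uniformQ : forall e (t : R), 0 <= t <= 1 ->
  Q [set f : cyl site R | f (inr e) <= t] = t%:E.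
Variable eps : R.
Hypothesis eps0 : 0 < eps.
Hypothesis etaQ : forall x, Q [set f : cyl site R | f (inl x) = 1] = eps%:E.
Variables mu mu0 : probability R R.
Hypotheses (mu_nonneg : supported_nonneg mu) (mu0_nonneg : supported_nonneg mu0).
Hypothesis Y_fin : (\int[Q]_f (Y_of mu (fun e f => edge_var f e) f)%:E < +oo)%E.
Hypothesis Y0_fin : (\int[Q]_f (Y_of mu0 (fun e f => edge_var f e) f)%:E < +oo)%E.

Let T f u v := passage_time (weight_eta mu mu0 f) u v.

Let weta0 f e : 0 <= weight_eta mu mu0 f e.
Proof. exact: weight_eta_ge0. Qed.

(** The way out of the run crosses columns of unknown type, so it is bounded through [weight_max].
    The offset [r] is the remainder of the target height modulo [k]. *)
Lemma sideways_bound (k : nat) (x : int) (r : nat) (e : R) : (0 < k)%N -> 0 < e ->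
  {ae Q, forall f, exists C : nat, forall j,
    T f (x, k%:Z *+ j) (0, r%:Z + k%:Z *+ j) <= j%:R * e + C%:R}.
Proof.
move=> k0 e0.
have [s sr si] := route_integrable indepQ uniformQ mu_nonneg mu0_nonneg Y_fin Y0_fin (x, 0) (0, r%:Z).
pose G f := min_time (weight_max mu mu0 f) (x, 0) s.
have W0 f e' : 0 <= weight_max mu mu0 f e' by exact: weight_max_ge0.
have GJ : depends_on (flatten (map (path_edges (x, 0)) s)) G.
  by move=> f g fg; apply: eq_min_time => e' eJ; rewrite /weight_max /weight fg.
have G0 f : 0 <= G f by exact: min_time_ge0.
apply: ae_imp (linear_bound indepQ uniformQ k0 GJ G0 si e0) => f [C hC].
exists C => j; apply: le_trans (hC j).
set v : vertex := (0, k%:Z *+ j).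
have -> : (x, k%:Z *+ j) = shift_vertex v (x, 0) by rewrite /shift_vertex /= addr0 add0r.
have -> : (0, r%:Z + k%:Z *+ j) = shift_vertex v (0, r%:Z) by rewrite /shift_vertex /= addr0.
rewrite /T passage_time_shift; apply: (le_trans (le_passage_time (w' := weight_max mu mu0 f \o shift_edge v) _ _ _ _)).
- by move=> e' /=.
- by move=> e' /=; exact: weight_eta_le.
- by rewrite -weight_max_shift; exact: passage_time_le_min_time.
Qed.

Lemma upper_bound_family (k : nat) (s : seq (seq vertex)) (b e : R) :
  (0 < k)%N -> route origin (0, k%:Z) s ->
  Q.-integrable setT (fun f => (min_time (weight mu0 f) origin s)%:E) ->
  (\int[Q]_f (min_time (weight mu0 f) origin s)%:E < b%:E)%E -> 0 < e ->
  {ae Q, forall f, exists C : R, forall n, T f origin (0, n%:Z) <= (n %/ k)%:R * (b + e) + C}.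
Proof.
move=> k0 sr si sb e0.
have w0 f e' : 0 <= weight mu0 f e' by exact: weight_ge0.
pose h f := min_time (weight mu0 f) origin s.
have mh : measurable_fun setT h.
  by apply: measurable_min_time => e'; exact: measurable_weight.
pose J := flatten (map (path_edges origin) s).
(* One more than the largest column of the family, because a horizontal edge also reads the next
   column. *)
pose L := (\max_(e' <- J) `|e'.1.1|%N).+1.
(* The position of the run is random, so the bound is needed for all columns [x] at once. *)
have bounds : {ae Q, forall f, forall x : int, exists C : nat, forall n,
    \sum_(j < n) h (shift_env (x, k%:Z *+ j) f) <= n%:R * b + C%:R}.
  apply: ae_countable => x.
  have mth := @measurable_shift_env R (x, 0).
  have Qth A : measurable A -> Q (@shift_env R (x, 0) @^-1` A) = Q A by exact: (shift_env_preserves indepQ uniformQ).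
  pose G f := h (shift_env (x, 0) f).
  have GJ : depends_on (map (shift_edge (x, 0)) J) G.
    by apply: min_time_depends_on => // f g e' fg; rewrite /weight fg.
  have iG : Q.-integrable setT (EFin \o G) by exact: (integrable_comp mth Qth).
  have Gb : (\int[Q]_f (G f)%:E < b%:E)%E.
    by rewrite (integral_comp mth Qth si).
  apply: ae_imp (ergodic_bound indepQ uniformQ k0 GJ iG Gb) => f [C hC].
  exists C => n; apply: le_trans (hC n).
  apply: ler_sum => j _; rewrite /G shift_env_comp /shift_vertex /=.
  by rewrite addr0 add0r.
have sides : {ae Q, forall f, forall p : int * nat, exists C : nat, forall j,
    T f (p.1, k%:Z *+ j) (0, p.2%:Z + k%:Z *+ j) <= j%:R * e + C%:R}.
  by apply: ae_countable => -[x r]; exact: sideways_bound.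
have run := ones_run indepQ L eps0 etaQ.
have both : {ae Q, forall f, (forall x : int, exists C : nat, forall n,
    \sum_(j < n) h (shift_env (x, k%:Z *+ j) f) <= n%:R * b + C%:R) /\
  (forall p : int * nat, exists C : nat, forall j,
    T f (p.1, k%:Z *+ j) (0, p.2%:Z + k%:Z *+ j) <= j%:R * e + C%:R)}.
  by apply: ae_imp2 bounds sides.
apply: ae_imp2 both run => f [fb fs] [x fx].
have [C1 hC1] := fb x.
have [C2 hC2] : exists C2 : nat -> nat, forall r j,
    T f (x, k%:Z *+ j) (0, r%:Z + k%:Z *+ j) <= j%:R * e + (C2 r)%:R.
  by have [C2 hC2] := choice (fun r => fs (x, r)); exists C2 => r j; exact: hC2.
have wE i e' : e' \in J -> weight_eta mu mu0 f (shift_edge (x, k%:Z *+ i) e') =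
    weight mu0 f (shift_edge (x, k%:Z *+ i) e').
  move=> eJ; have [h1 h2] := column_bound x (le_bigmax_mem (fun e' : edge => `|e'.1.1|%N) eJ).
  rewrite /weight_eta /tau_eta /= !fx ?eqxx //=; by case: ifP.
have step i : T f (x, k%:Z *+ i) (x, k%:Z *+ i.+1) <= h (shift_env (x, k%:Z *+ i) f).
  set v : vertex := (x, k%:Z *+ i).
  have -> : v = shift_vertex v origin by rewrite /shift_vertex /= !add0r.
  have -> : (x, k%:Z *+ i.+1) = shift_vertex v (0, k%:Z).
    by rewrite /shift_vertex /= add0r mulrS.
  rewrite /T passage_time_shift.
  apply: le_trans (passage_time_le_min_time _ sr) _; first by move=> e' /=.
  rewrite (eq_min_time (w' := weight mu0 f \o shift_edge v)).
    by rewrite /h /shift_vertex /= !add0r.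
  by move=> e' eJ /=; exact: wE.
have climb j : T f (x, 0) (x, k%:Z *+ j) <= \sum_(i < j) h (shift_env (x, k%:Z *+ i) f).
  elim: j => [|j IH]; first by rewrite big_ord0 /T passage_time_refl.
  rewrite big_ord_recr /=; apply: le_trans (passage_time_triangle _ _ (x, k%:Z *+ j) _) _ => //.
  by apply: lerD IH (step j).
(* Reach the column, climb [n %/ k] periods, step sideways. Only [k] remainders occur, so their
   constants have a maximum. *)
exists (T f origin (x, 0) + C1%:R + (\max_(r < k) C2 r)%:R) => n.
set j := (n %/ k)%N; set r := (n %% k)%N.
have nE : (0, n%:Z) = (0, r%:Z + k%:Z *+ j).
  by rewrite {1}(divn_eq n k) addnC mulnC PoszD PoszM -mulr_natr natz.
have C2r : (C2 r <= \max_(r < k) C2 r)%N.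
  have rk : (r < k)%N by rewrite ltn_mod.
  exact: (leq_bigmax (Ordinal rk)).
have t1 : T f origin (0, n%:Z) <= T f origin (x, 0) + T f (x, 0) (0, n%:Z) by exact: passage_time_triangle.
have t2 : T f (x, 0) (0, n%:Z) <= T f (x, 0) (x, k%:Z *+ j) + T f (x, k%:Z *+ j) (0, n%:Z) by exact: passage_time_triangle.
have t3 := climb j; have t4 := hC1 j; have t5 := hC2 r j; rewrite -nE in t5.
have t6 : (C2 r)%:R <= (\max_(r < k) C2 r)%:R :> R by rewrite ler_nat.
rewrite mulrDr; move: t1 t2 t3 t4 t5 t6.
move: (T f origin (0, n%:Z)) (T f origin (x, 0)) (T f (x, 0) (0, n%:Z)) (T f (x, 0) (x, k%:Z *+ j))
  (T f (x, k%:Z *+ j) (0, n%:Z)) (\sum_(_ < j) _) (j%:R * e) (j%:R * b) ((C2 r)%:R) ((\max_(_ < k) _)%:R)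
  (C1%:R) => y1 y2 y3 y4 y5 y6 y7 y8 y9 y10 y11; lra.
Qed.

End upper_bound.

(** * The time constant and the almost sure limit *)

Section limit.
Context {R : realType} (Q : probability (cyl site R) R).
Hypothesis indepQ : forall (J : seq site) (B : site -> set R), uniq J ->
  (forall i, measurable (B i)) ->
  Q (box J B) = (\prod_(i <- J) Q [set f | B i (f i)])%E.
Hypothesis uniformQ : forall e (t : R), 0 <= t <= 1 ->
  Q [set f : cyl site R | f (inr e) <= t] = t%:E.
Variable mu0 : probability R R.
Hypothesis mu0_nonneg : supported_nonneg mu0.
Hypothesis Y0_fin : (\int[Q]_f (Y_of mu0 (fun e f => edge_var f e) f)%:E < +oo)%E.

Let T0 f u v := passage_time (weight mu0 f) u v.

Let w0_ge0 f e : 0 <= weight mu0 f e.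
Proof. exact: weight_ge0. Qed.

Let measurable_T0 u v : measurable_fun setT (fun f => T0 f u v).
Proof. by apply: measurable_passage_time => // e; exact: measurable_weight. Qed.

Let T0_ge0 f u v : 0 <= T0 f u v.
Proof. exact: passage_time_ge0. Qed.

Let mean_time n := fine (\int[Q]_f (T0 f origin (0, n%:Z))%:E)%E.

Definition time_constant : R := inf [set mean_time n / n%:R | n in [set n | (0 < n)%N]].

Let weight_max_diag f : weight_max mu0 mu0 f = weight mu0 f.
Proof. by apply/funext => e; rewrite /weight_max maxxx. Qed.

Let integrable_route u v : exists2 s, route u v s &
  Q.-integrable setT (fun f => (min_time (weight mu0 f) u s)%:E).
Proof.
have [s sr si] := route_integrable indepQ uniformQ mu0_nonneg mu0_nonneg Y0_fin Y0_fin u v.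
exists s => //; apply: (eq_integrable measurableT (fun f => (min_time (weight_max mu0 mu0 f) u s)%:E)) => //.
by move=> f _; rewrite weight_max_diag.
Qed.

Let integrable_T0 u v : Q.-integrable setT (fun f => (T0 f u v)%:E).
Proof.
have [s sr si] := integrable_route u v.
apply: (le_integrable measurableT _ _ si); first exact/measurable_EFinP.
by move=> f _; rewrite /= lee_fin !ger0_norm ?min_time_ge0 // passage_time_le_min_time.
Qed.

Let mean_timeE n : (\int[Q]_f (T0 f origin (0, n%:Z))%:E)%E = (mean_time n)%:E.
Proof. by rewrite fineK //; exact: (integrable_fin_num measurableT (integrable_T0 _ _)). Qed.

Let mean_time_ge0 n : 0 <= mean_time n.
Proof. by apply: fine_ge0; apply: integral_ge0 => f _; rewrite lee_fin. Qed.

Let has_inf_means : has_inf [set mean_time n / n%:R | n in [set n | (0 < n)%N]].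
Proof.
split; first by exists (mean_time 1 / 1%:R), 1%N.
by exists 0 => _ [n _ <-]; rewrite divr_ge0.
Qed.

Lemma time_constant_ge0 : 0 <= time_constant.
Proof.
apply: lb_le_inf; first by case: has_inf_means.
by move=> _ [n _ <-]; rewrite divr_ge0.
Qed.

Let mean_time_ge n : n%:R * time_constant <= mean_time n.
Proof.
case: n => [|n]; first by rewrite mul0r.
rewrite mulrC -ler_pdivlMr ?ltr0n //; apply: ge_inf; first by case: has_inf_means.
by exists n.+1.
Qed.

(** [k] nearly attains the infimum, and means over growing finite families tend to the mean passage
    time. Starting at [N0] keeps the integrable route inside every family, which provides the
    domination. *)
Let cheap_family (e : R) : 0 < e -> exists k s, [/\ (0 < k)%N, route origin (0, k%:Z) s,
  Q.-integrable setT (fun f => (min_time (weight mu0 f) origin s)%:E) &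
  (\int[Q]_f (min_time (weight mu0 f) origin s)%:E < (k%:R * (time_constant + e))%:E)%E].
Proof.
move=> e0; have [_ [k k0 <-] lt] := inf_adherent e0 has_inf_means.
have {}lt : mean_time k < k%:R * (time_constant + e).
  by rewrite mulrC -ltr_pdivrMr ?ltr0n.
have [s sr si] := integrable_route origin (0, k%:Z).
have [N0 sN0] := sub_routes sr.
have s0 : s != [::] by case/andP: sr.
pose F N f := min_time (weight mu0 f) origin (routes origin (0, k%:Z) (N + N0)).
have F0 N f : 0 <= F N f by exact: min_time_ge0.
have Fs N f : F N f <= min_time (weight mu0 f) origin s.
  by apply: sub_min_time => // p /sN0; apply: routes_homo; exact: leq_addl.
have mF N : measurable_fun setT (F N).
  by apply: measurable_min_time => e'; exact: measurable_weight.
have iF N : Q.-integrable setT (EFin \o F N).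
  apply: (le_integrable measurableT _ _ si); first exact/measurable_EFinP.
  by move=> f _; rewrite /= lee_fin !ger0_norm ?min_time_ge0.
have cv : (\int[Q]_f (F N f)%:E)%E @[N --> \oo] --> (\int[Q]_f (T0 f origin (0, k%:Z))%:E)%E.
  apply: (dominated_cvg_integral _ _ _ si) => //.
    apply: aeW => f.
    have cvf : min_time (weight mu0 f) origin (routes origin (0, k%:Z) N) @[N --> \oo] -->
      T0 f origin (0, k%:Z) by exact: min_time_routes_cvg.
    by move: cvf; rewrite -(cvg_shiftn N0).
  by move=> N f; rewrite ger0_norm.
have gap0 : 0 < k%:R * (time_constant + e) - mean_time k by rewrite subr_gt0.
move: cv; rewrite mean_timeE => /fine_cvgP[_ /cvgrPdist_lt/(_ _ gap0)[N _ /(_ N (leqnn _)) /= near_]].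
exists k, (routes origin (0, k%:Z) (N + N0)); split => //.
- exact: routesP.
- exact: iF.
rewrite -[ltLHS](fineK (integrable_fin_num measurableT (iF N))) lte_fin.
move: near_; rewrite ltr_distl ltrBlDr addrC subrK => /andP[+ _]; exact.
Qed.

Variable mu : probability R R.
Hypothesis mu_nonneg : supported_nonneg mu.
Hypothesis Y_fin : (\int[Q]_f (Y_of mu (fun e f => edge_var f e) f)%:E < +oo)%E.
Hypothesis order_mu : concave_order mu0 mu.
Variable eps : R.
Hypothesis eps0 : 0 < eps.
Hypothesis etaQ : forall x, Q [set f : cyl site R | f (inl x) = 1] = eps%:E.

Let a (n : nat) f := passage_time (weight_eta mu mu0 f) origin (0, n%:Z).

Let weta0 f e : 0 <= weight_eta mu mu0 f e.
Proof. exact: weight_eta_ge0. Qed.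

Let a_ge0 n f : 0 <= a n f.
Proof. exact: passage_time_ge0. Qed.

Let measurable_a n : measurable_fun setT (a n).
Proof. by apply: measurable_passage_time => // e; exact: measurable_weight_eta. Qed.

Let a0 f : a 0 f = 0.
Proof. exact: passage_time_refl. Qed.

Let upper (e : R) : 0 < e -> {ae Q, forall f, exists C : R, forall n,
  a n f <= n%:R * (time_constant + e) + C}.
Proof.
move=> e0; have e20 : 0 < e / 2 by rewrite divr_gt0.
have [k [s [k0 sr si sb]]] := cheap_family e20.
have ke20 : 0 < k%:R * (e / 2) by rewrite mulr_gt0 ?ltr0n.
(* Half of [e] is the excess of the family, the other half pays for leaving the run; the factor [k]
   converts periods into height. *)
have := upper_bound_family indepQ uniformQ eps0 etaQ mu_nonneg mu0_nonneg Y_fin Y0_fin k0 sr si sb ke20.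
apply: ae_imp => f [C hC]; exists C => n; apply: le_trans (hC n) _.
rewrite lerD2r -mulrDr mulrA -natrM -addrA -splitr.
rewrite ler_wpM2r ?addr_ge0 ?time_constant_ge0 ?(ltW e0) // ler_nat.
exact: leq_trunc_div.
Qed.

Let th := @shift_env R (0, 1).

Let mth : measurable_fun setT th.
Proof. exact: measurable_shift_env. Qed.

Let Qth A : measurable A -> Q (th @^-1` A) = Q A.
Proof. exact: (shift_env_preserves indepQ uniformQ). Qed.

Let a_shift m n f : passage_time (weight_eta mu mu0 f) (0, m%:Z) (0, (m + n)%N%:Z) =
  a n (iter m th f).
Proof.
have -> : (0, m%:Z) = shift_vertex (0, m%:Z) origin by rewrite /shift_vertex /= !add0r.
have -> : (0, (m + n)%N%:Z) = shift_vertex (0, m%:Z) (0, n%:Z).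
  by rewrite /shift_vertex /= addr0 PoszD addrC.
rewrite passage_time_shift /a /th iter_shift_env weight_eta_shift.
by rewrite -[1 *+ m]/(m%:R) natz.
Qed.

Let a_subadd m n f : a (m + n)%N f <= a m f + a n (iter m th f).
Proof. by rewrite -a_shift; exact: passage_time_triangle. Qed.

Let a1_fin : (\int[Q]_f (a 1 f)%:E < +oo)%E.
Proof.
have [s sr si] := route_integrable indepQ uniformQ mu_nonneg mu0_nonneg Y_fin Y0_fin origin (0, 1).
have wmax0 f e : 0 <= weight_max mu mu0 f e by exact: weight_max_ge0.
apply: le_lt_trans (integrable_lty measurableT si).
apply: ge0_le_integral => //.
- by move=> f _; rewrite lee_fin.
- exact/measurable_EFinP.
- by apply/measurable_EFinP; apply: measurable_min_time => e; exact: measurable_weight_max.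
move=> f _; rewrite lee_fin.
apply: le_trans (passage_time_le_min_time (wmax0 f) sr).
by apply: le_passage_time => // e; exact: weight_eta_le.
Qed.

Let mean_a_ge n : ((n%:R * time_constant)%:E <= \int[Q]_f (a n f)%:E)%E.
Proof.
apply: (@le_trans _ _ (\int[Q]_f (T0 f origin (0, n%:Z))%:E)%E).
  by rewrite mean_timeE lee_fin.
exact: (passage_time_comparison indepQ uniformQ mu_nonneg mu0_nonneg order_mu (integrable_T0 _ _)).
Qed.

Let low (c : R) : set (cyl site R) := [set f | forall C : nat, exists n, a n f + C%:R < n%:R * c].

Let measurable_low c : measurable (low c).
Proof.
have -> : low c = \bigcap_(C : nat) \bigcup_(n : nat) [set f | a n f + C%:R < n%:R * c].
  apply/seteqP; split => f /= h.
    by move=> C _; have [n hn] := h C; exists n.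
  by move=> C; have [n _ hn] := h C I; exists n.
apply: bigcapT_measurable => C; apply: bigcupT_measurable => n.
by apply: measurable_set_lt => //; apply: measurable_funD.
Qed.

Let a_next n f : a n.+1 f <= a 1 f + a n (th f).
Proof. by rewrite -[n.+1]/(1 + n)%N; exact: (a_subadd 1 n f). Qed.

Let a_prev n f : a n (th f) <= passage_time (weight_eta mu mu0 f) (0, 1%N%:Z) origin + a n.+1 f.
Proof. by rewrite -(a_shift 1 n f); exact: passage_time_triangle. Qed.

Let nat_above (x : R) : exists C : nat, x <= C%:R.
Proof. by exists (Num.truncn x).+1; exact/ltW/truncnS_gt. Qed.

(** Passing between [f] and [th f] changes the times by at most a passage time between the origin
    and [(0, 1)], and the index by one; the arbitrary [C] absorbs both. *)
Let low_shift c f : 0 <= c -> low c (th f) <-> low c f.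
Proof.
move=> c0; split => h C.
  have [C' hC'] := nat_above (C%:R + a 1 f).
  have [n hn] := h C'; exists n.+1; have := a_next n f.
  rewrite -natr1 mulrDl mul1r; lra.
have [C' hC'] := nat_above (C%:R + passage_time (weight_eta mu mu0 f) (0, 1%N%:Z) origin + c).
have [[|n] hn] := h C'.
  by exists 0%N; move: hn; rewrite !a0 mul0r ltNge add0r ler0n.
exists n; have := a_prev n f; move: hn; rewrite -natr1 mulrDl mul1r; lra.
Qed.

Let low_null c : 0 <= c < time_constant -> {ae Q, forall f, ~ low c f}.
Proof.
move=> /andP[c0 cm]; suff Q0 : Q (low c) = 0%E.
  by exists (low c); split => // f /= /contrapT.
have [p pE] : exists p, Q (low c) = p%:E.
  by exists (fine (Q (low c))); rewrite fineK // fin_num_measure.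
have p01 : 0 <= p <= 1 by rewrite -!lee_fin -pE measure_ge0 probability_le1.
suff key (e : R) : 0 < e -> p * (time_constant - c) <= e.
  rewrite pE; congr (_%:E); apply/eqP; rewrite eq_le; case/andP: p01 => p0 p1; rewrite p0 andbT.
  have : p * (time_constant - c) <= 0 by apply/ler_addgt0Pr => e e0; rewrite add0r; exact: key.
  by rewrite pmulr_lle0 // subr_gt0.
move=> e0; have e20 : 0 < e / 2 by rewrite divr_gt0.
(* Invariant because [low c] is. A mean of at least [time_constant] forces
   [p (time_constant - c) <= e]. *)
pose r (f : cyl site R) := c + (time_constant + e - c) * \1_(~` low c) f.
have mnl : measurable (~` low c) by exact: measurableC.
have m0 := time_constant_ge0.
have d0 : 0 <= time_constant + e - c by move: cm e0; lra.
have := @subadditive_mean_le _ _ R Q th mth Qth a r time_constant measurable_a a_ge0 a0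
  a_subadd a1_fin _ _ _ _ mean_a_ge.
have ->// : (\int[Q]_f (r f)%:E)%E = (c + (time_constant + e - c) * (1 - p))%:E.
  rewrite (eq_integral (fun f => c%:E + (time_constant + e - c)%:E * (\1_(~` low c) f)%:E)%E); last first.
    by move=> f _; rewrite /r EFinD EFinM.
  rewrite ge0_integralD //; first last.
  - by apply: measurable_funeM; apply/measurable_EFinP; exact: measurable_indic.
  - by move=> f _; rewrite -EFinM lee_fin mulr_ge0.
  rewrite integral_cst // ge0_integralZl_EFin //; last by apply/measurable_EFinP; exact: measurable_indic.
  rewrite [X in (c%:E * X + _)%E](_ : _ = 1%E); last exact: (@probability_setT _ _ _ Q).
  rewrite mule1 integral_indic // setIT.
  rewrite [X in (_ + _ * X)%E](_ : _ = (1 - p)%:E); last by apply: etrans (probability_setC _ (measurable_low c)) _; rewrite pE EFinB.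
  by rewrite -EFinM -EFinD.
move=> H; have {H} : (time_constant%:E <= (c + (time_constant + e - c) * (1 - p))%:E)%E.
  apply: H.
  - apply: measurable_funD => //; apply: measurable_funM => //; exact: measurable_indic.
  - by move=> f; rewrite addr_ge0 // mulr_ge0.
  - move=> f; rewrite /r !indicE (_ : (th f \in ~` low c) = (f \in ~` low c)) //.
    by apply/idP/idP; rewrite !inE /=; apply: contra_not; case: (low_shift f c0).
  - apply: ae_imp (upper e20) => f [C hC].
    have [fl|fl] := pselect (low c f).
      (* A good length must be positive; at length 0 both sides vanish and the strict inequality
         fails. *)
      have [[|n] hn] := fl 0%N; first by move: hn; rewrite a0 mul0r addr0 ltxx.
      by exists n.+1 => //; rewrite /r indicE memNset //= mulr0 addr0; move: hn; rewrite addr0 => /ltW.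
    (* From here on [C] is at most [N e / 2], which turns the affine upper bound into the pure rate
       [time_constant + e]. *)
    have [N hN] := nat_above (C / (e / 2)).
    exists N.+1 => //; rewrite /r indicE mem_set //= mulr1.
    apply: le_trans (hC _) _; rewrite addrCA subrr addr0.
    have hN' : C <= N%:R * (e / 2) by rewrite -ler_pdivrMr.
    rewrite -natr1; move: hN' m0 e0; nra.
rewrite lee_fin; move: p01 => /andP[p0 p1]; nra.
Qed.

Lemma passage_time_eta_cvg :
  {ae Q, forall f, passage_time (weight_eta mu mu0 f) origin (0, n%:Z) / n%:R @[n --> \oo]
    --> time_constant}.
Proof.
have up : {ae Q, forall f, forall i : nat, exists C : R, forall n,
    a n f <= n%:R * (time_constant + i.+1%:R^-1) + C}.
  by apply: ae_countable => i; apply: upper; rewrite invr_gt0.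
have lo : {ae Q, forall f, forall i : nat, 0 <= time_constant - i.+1%:R^-1 ->
    ~ low (time_constant - i.+1%:R^-1) f}.
  apply: ae_countable => i.
  have [h|h] := leP 0 (time_constant - i.+1%:R^-1); last by apply: aeW.
  have c01 : 0 <= time_constant - i.+1%:R^-1 < time_constant.
    by rewrite h /= ltrBlDr ltrDl invr_gt0.
  by apply: ae_imp (low_null c01) => f hf _.
apply: ae_imp2 up lo => f hup hlo.
apply/cvgrPdist_le => e e0.
pose i := Num.truncn (e / 2)^-1.
have e20 : 0 < e / 2 by rewrite divr_gt0.
have ie : i.+1%:R^-1 <= e / 2.
  by rewrite -[leRHS]invrK lef_pV2 ?posrE ?invr_gt0 // ltW // truncnS_gt.
have [C hC] := hup i.
have [C' hC'] : exists C' : R, forall n, n%:R * (time_constant - i.+1%:R^-1) - C' <= a n f.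
  (* A negative rate lies below the nonnegative times anyway; [low_null] covers the others. *)
  have [h|h] := leP 0 (time_constant - i.+1%:R^-1).
    have [C' hC'] : exists C' : nat, forall n, ~ a n f + C'%:R < n%:R * (time_constant - i.+1%:R^-1).
      have /existsNP[C' hC'] := hlo i h; exists C' => n hn; apply: hC'; by exists n.
    exists C'%:R => n; rewrite lerBlDr leNgt; exact/negP.
  exists 0 => n; rewrite subr0; apply: le_trans (a_ge0 n f).
  by rewrite mulr_ge0_le0 // ltW.
have [N hN] := nat_above ((`|C| + `|C'|) / (e / 2)).
exists N.+1 => // n /= Nn.
have n0 : 0 < n%:R :> R by rewrite ltr0n (leq_trans _ Nn).
have big : `|C| + `|C'| <= n%:R * (e / 2).
  rewrite -ler_pdivrMr //; apply: le_trans hN _.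
  by rewrite ler_nat ltnW.
have C1 := ler_norm C; have C1' := ler_norm C'; have C2 := normr_ge0 C; have C2' := normr_ge0 C'.
have ine : n%:R * i.+1%:R^-1 <= n%:R * (e / 2) by rewrite ler_wpM2l // ltW.
rewrite distrC ler_distl -/(a n f) ler_pdivlMr // ler_pdivrMr //.
have u1 := hC n; have u2 := hC' n; move: u1 u2 ine big; rewrite mulrDr mulrBr => u1 u2 ine big.
have e2 : n%:R * e = n%:R * (e / 2) + n%:R * (e / 2) by rewrite -mulrDr -splitr.
rewrite mulrBl mulrDl [time_constant * _]mulrC [e * _]mulrC e2.
move: (n%:R * time_constant) (n%:R * i.+1%:R^-1) (n%:R * (e / 2)) (a n f) u1 u2 ine big =>
  x1 x2 x3 x4 u1 u2 ine big.
by apply/andP; split; lra.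
Qed.

End limit.

(** * Transfer to the given probability space *)

Lemma scalev_e2 (n : nat) : scalev n e2 = (0, n%:Z).
Proof. by rewrite /scalev /e2 /= mul0rn -[1 *+ n]/(n%:R) natz. Qed.

(** Dominated convergence for the indicators of the deviation events, which eventually vanish at
    almost every point. *)
Lemma ae_cvg_in_probability d (T : measurableType d) (R : realType) (P : probability T R)
    (u : nat -> T -> R) (l : R) :
  (forall n, measurable_fun setT (u n)) -> {ae P, forall w, u n w @[n --> \oo] --> l} ->
  forall delta, 0 < delta ->
  fine (P [set w | delta < `| u n w - l |]) @[n --> \oo] --> 0.
Proof.
move=> mu_ ul delta d0.
have mS n : measurable [set w | delta < `| u n w - l |].
  apply: measurable_set_lt => //; apply: measurableT_comp => //.
  exact: measurable_funB.
have cv : (\int[P]_w (\1_[set w | delta < `| u n w - l |] w)%:E)%E @[n --> \oo] --> (\int[P]_w (cst 0 w)%:E)%E.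
  apply: (dominated_cvg_integral (f := cst 0) (g := cst 1)) => //.
  - by move=> n; exact: measurable_indic.
  - apply: ae_imp ul => w /cvgrPdist_lt/(_ delta d0)[N _ hN].
    apply: cvg_near_cst; exists N => // n Nn; rewrite indicE memNset //=.
    by apply/negP; rewrite -leNgt distrC ltW //; exact: hN.
  - exact: finite_measure_integrable_cst.
  - by move=> n w; rewrite indicE; case: (_ \in _); rewrite ?normr1 ?normr0.
have PE n : P [set w | delta < `| u n w - l |] =
    (\int[P]_w (\1_[set w | delta < `| u n w - l |] w)%:E)%E.
  by rewrite integral_indic // setIT.
rewrite integral0 in cv; under eq_fun do rewrite PE.
exact: fine_cvg cv.
Qed.

Lemma measurable_Y_of {R : realType} (nu : probability R R) : supported_nonneg nu ->
  measurable_fun setT (fun f : cyl site R => Y_of nu (fun e f => edge_var f e) f).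
Proof.
move=> nn; rewrite (_ : (fun _ => _) = fun f : cyl site R =>
   Num.min (weight nu f (origin, false)) (Num.min (weight nu f ((-1, 0), false))
   (Num.min (weight nu f (origin, true)) (Num.min (weight nu f ((0, -1), true))
     (weight nu f (origin, false)))))); last first.
  by apply/funext => f; rewrite /Y_of /origin_edges !big_cons big_nil.
by do 4!(apply: measurable_minr; first exact: measurable_weight); exact: measurable_weight.
Qed.

Lemma Y_of_ge0 {R : realType} d (T : measurableType d) (nu : probability R R)
  (xi : edge -> T -> R) w : supported_nonneg nu -> 0 <= Y_of nu xi w.
Proof.
move=> nn; rewrite /Y_of; elim/big_ind : _ => [|x y x0 y0|e _]; [exact: qf_nonneg| |exact: qf_nonneg].
by rewrite le_min x0.
Qed.

Theorem theorem6 (R : realType) (d : measure_display) (Omega : measurableType d)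
  (P : probability Omega R) (eps : R)
  (eta : int -> Omega -> R) (xi : edge -> Omega -> R)
  (mu mu0 : probability R R) :
  0 < eps < 1 ->
  (* eta_x i.i.d. Bernoulli(eps), xi_e i.i.d. uniform on [0,1], all independent *)
  mutually_independent P (joint_family eta xi) ->
  (forall x, P [set w | eta x w = 1] = eps%:E /\ P [set w | eta x w = 0] = (1 - eps)%:E) ->
  (forall e (t : R), 0 <= t <= 1 -> P [set w | xi e w <= t] = t%:E) ->
  (* F, F0 distribution functions of probability measures on [0, oo) *)
  supported_nonneg mu -> supported_nonneg mu0 ->
  concave_order mu0 mu ->
  (\int[P]_w (Y_of mu xi w)%:E < +oo)%E ->
  (\int[P]_w (Y_of mu0 xi w)%:E < +oo)%E ->
  exists m : R,
    (* m = mu_{F0}(e2): limit in probability of T_{F0}(0, n e2)/n *)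
    (forall delta : R, 0 < delta ->
       (fun n : nat => fine (P [set w | delta <
          `| passage_time (fun e => qf mu0 (xi e w)) origin (scalev n e2) / n%:R - m |]))
       @ \oo --> 0)
    /\
    (* T_eta(0, n e2)/n --> mu_{F0}(e2) almost surely *)
    {ae P, forall w,
       (fun n : nat => passage_time (tau_eta mu mu0 (fun x => eta x w == 1) (fun e => xi e w))
                         origin (scalev n e2) / n%:R) @ \oo --> m}.
Proof.
move=> /andP[eps0 _] [mfam indep] etaP uniformP mu_nonneg mu0_nonneg order_mu Yfin Y0fin.
(* The sample of all variables as one point of the coordinate space; [Q] below is its law, and both
   passage times are functions of [X w]. *)
pose X (w : Omega) : cyl site R := fun i => joint_family eta xi i w.
have mX : measurable_fun setT X by exact: measurable_to_cyl.
pose X' : {mfun Omega >-> cyl site R} := HB.pack X (isMeasurableFun.Build _ _ _ _ X mX).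
pose Q : probability (cyl site R) R := distribution P X'.
have QE A : measurable A -> P (X @^-1` A) = Q A by [].
have indepQ (J : seq site) (B : site -> set R) : uniq J -> (forall i, measurable (B i)) ->
    Q (box J B) = (\prod_(i <- J) Q [set f | B i (f i)])%E by exact: indep.
have uniformQ e (t : R) : 0 <= t <= 1 -> Q [set f : cyl site R | f (inr e) <= t] = t%:E.
  exact: uniformP.
have etaQ x : Q [set f : cyl site R | f (inl x) = 1] = eps%:E by exact: (etaP x).1.
have YQ nu : supported_nonneg nu -> (\int[P]_w (Y_of nu xi w)%:E < +oo)%E ->
    (\int[Q]_f (Y_of nu (fun e f => edge_var f e) f)%:E < +oo)%E.
  move=> nn; rewrite -(ge0_integral_comp mX QE) //.
    by apply/measurable_EFinP; exact: measurable_Y_of.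
  by move=> f; rewrite lee_fin Y_of_ge0.
have orderxx : concave_order mu0 mu0 by move=> *; exact: lexx.
have lim nu : supported_nonneg nu -> concave_order mu0 nu ->
    (\int[P]_w (Y_of nu xi w)%:E < +oo)%E ->
    {ae P, forall w, passage_time (weight_eta nu mu0 (X w)) origin (scalev n e2) / n%:R
      @[n --> \oo] --> time_constant Q mu0}.
  move=> nn ord Yn.
  have cvQ := passage_time_eta_cvg indepQ uniformQ mu0_nonneg (YQ _ mu0_nonneg Y0fin) nn
    (YQ _ nn Yn) ord eps0 etaQ.
  apply: ae_imp (ae_comp mX QE cvQ) => w.
  rewrite (_ : (fun n : nat => passage_time _ origin (0, n%:Z) / n%:R) =
    (fun n => passage_time (weight_eta nu mu0 (X w)) origin (scalev n e2) / n%:R)) //.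
  by apply/funext => n; rewrite scalev_e2.
exists (time_constant Q mu0); split; last exact: (lim mu).
apply: ae_cvg_in_probability => [n|].
  apply: measurable_funM => //.
  have mT := measurable_passage_time (measurable_weight mu0_nonneg) origin (scalev n e2)
    (fun f e => weight_ge0 mu0_nonneg f e).
  exact: (measurableT_comp mT mX).
(* With F = F_0 the type of a column does not influence its weights, so the limit just proved
   concerns the homogeneous model. *)
apply: ae_imp (lim mu0 mu0_nonneg orderxx Y0fin) => w.
rewrite (_ : weight_eta mu0 mu0 (X w) = weight mu0 (X w)) //.
by apply/funext => e; case: (weight_eta_cases mu0 mu0 (X w) e) => ->.
Qed.
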